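(* For every polynomial $p$ with real coefficients there exist a finite configuration $A\subseteq\mathbb N^n$ and a Markov basis $M$ of $I_A$ such that $\deg_M>p(\deg_{\mathcal C_A})$, $\deg_{\mathcal U_A}>p(\deg_{\mathcal C_A})$ and $\deg_{Gr_A}>p(\deg_{\mathcal C_A})$. That is, the degrees of the elements of a Markov basis, of the universal Gröbner basis and of the Graver basis of a toric ideal cannot be bounded above by a polynomial in the maximal degree of the circuits.
   Context: Let $\mathbb K$ be a field and $A=\{\mathbf a_1,\dots,\mathbf a_m\}\subseteq\mathbb Z^n$ finite. For $\mathbf u\in\mathbb N^m$, $\mathbf x^{\mathbf u}=x_1^{u_1}\cdots x_m^{u_m}$ has degree $u_1+\dots+u_m$ and $A$-degree $\sum u_i\mathbf a_i$. The toric ideal $I_A\subseteq\mathbb K[x_1,\dots,x_m]$ is generated by all binomials $\mathbf x^{\mathbf u}-\mathbf x^{\mathbf v}$ of equal $A$-degree. The degree of a binomial is the maximum of the degrees of its two monomials. $Gr_A$ (Graver basis) is the set of primitive binomials: irreducible binomials $\mathbf x^{\mathbf u}-\mathbf x^{\mathbf v}\in I_A$ such that no other binomial $\mathbf x^{\mathbf w}-\mathbf x^{\mathbf z}\in I_A$ has $\mathbf x^{\mathbf w}\mid\mathbf x^{\mathbf u}$, $\mathbf x^{\mathbf z}\mid\mathbf x^{\mathbf v}$. $\mathcal U_A$ is the union of all reduced Gröbner bases of $I_A$. $\mathcal C_A$ is the set of circuits (irreducible nonzero binomials of $I_A$ of minimal support). A Markov basis is a generating set of $I_A$ of binomials minimal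 under inclusion. For a finite set $S$ of binomials, $\deg_S$ is the maximal degree of its elements. *)

(* Defs.v *)
From mathcomp Require Import all_boot all_order all_algebra.
From mathcomp Require Import classical_sets reals.
From mathcomp Require Import mpoly.

Set Implicit Arguments.
Unset Strict Implicit.
Unset Printing Implicit Defensive.

Import Order.TTheory GRing.Theory Num.Theory.

Local Open Scope classical_set_scope.
Local Open Scope ring_scope.

Definition ideal_gen (R : comNzRingType) (S : set R) : set R :=
  [set f | exists (k : nat) (c g : 'I_k -> R),
     (forall i, S (g i)) /\ f = \sum_(i < k) c i * g i].

Definition irreducible_elt (R : comUnitRingType) (f : R) : Prop :=
  [/\ f != 0, f \isn't a GRing.unit &
      forall g h : R, f = g * h -> (g \is a GRing.unit) \/ (h \is a GRing.unit)].

Section ToricIdeals.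
Variables (K : fieldType) (n m : nat).
Implicit Types (f g : {mpoly K[m]}) (u v w z : 'X_{1..m}).
Implicit Types (S I M : set {mpoly K[m]}).

Definition binom u v : {mpoly K[m]} := 'X_[u] - 'X_[v].

(* Binomials are nonzero by convention: the two monomials are distinct. *)
Definition is_binomial : set {mpoly K[m]} :=
  [set f | exists u v, u != v /\ f = binom u v].

Definition pdeg f : nat := (\max_(u <- msupp f) mdeg u)%N.

(* deg_S = d, the maximum being attained. *)
Definition is_max_degree S (d : nat) : Prop :=
  (exists2 f, S f & pdeg f = d) /\ (forall f, S f -> (pdeg f <= d)%N).

(* The indices of the variables occurring in f. *)
Definition vars f : {set 'I_m} := [set i | has (fun u => (0 < u i)%N) (msupp f)].

(* A configuration a_1, ..., a_m in Z^n is a map 'I_m -> 'rV[int]_n; it is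
   required to be injective in the statement, so that it is a set of m vectors. *)
Implicit Type A : 'I_m -> 'rV[int]_n.

Definition Adegree A u : 'rV[int]_n := \sum_(i < m) A i *+ u i.

Definition toric_ideal A : set {mpoly K[m]} :=
  ideal_gen [set f | exists u v, Adegree A u = Adegree A v /\ f = binom u v].

Definition graver A : set {mpoly K[m]} :=
  [set f | exists u v,
     [/\ f = binom u v, toric_ideal A f, irreducible_elt f &
         forall w z, w != z -> toric_ideal A (binom w z) ->
           (w <= u)%MM -> (z <= v)%MM -> w = u /\ z = v]].

Definition circuits A : set {mpoly K[m]} :=
  [set f | [/\ is_binomial f, toric_ideal A f, irreducible_elt f &
     forall g, is_binomial g -> toric_ideal A g -> ~~ (vars g \proper vars f)]].

Definition markov_basis A M : Prop :=
  [/\ M `<=` is_binomial, ideal_gen M = toric_ideal A &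
      forall M', M' `<=` M -> ideal_gen M' = toric_ideal A -> M' = M].

Definition monomial_order (le : rel 'X_{1..m}) : Prop :=
  [/\ total le, antisymmetric le, transitive le,
      (forall u, le 0%MM u) &
      (forall u v w, le u v -> le (u + w)%MM (v + w)%MM)].

Definition is_lead (le : rel 'X_{1..m}) f u : Prop :=
  u \in msupp f /\ (forall v, v \in msupp f -> le v u).

Definition initial_ideal (le : rel 'X_{1..m}) S : set {mpoly K[m]} :=
  ideal_gen [set g | exists f u, [/\ S f, is_lead le f u & g = 'X_[u]]].

Definition groebner_basis (le : rel 'X_{1..m}) I (G : seq {mpoly K[m]}) : Prop :=
  [set` G] `<=` I /\ initial_ideal le [set` G] = initial_ideal le I.

(* The second condition excludes 0, which has no leading monomial. *)
Definition reduced_groebner_basis (le : rel 'X_{1..m}) I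
    (G : seq {mpoly K[m]}) : Prop :=
  [/\ groebner_basis le I G,
      (forall g, g \in G -> exists u, is_lead le g u /\ g@_u = 1) &
      (forall g g' u v, g \in G -> g' \in G -> g != g' ->
         is_lead le g u -> v \in msupp g' -> ~~ (u <= v)%MM)].

Definition universal_groebner A : set {mpoly K[m]} :=
  [set f | exists (le : rel 'X_{1..m}) (G : seq {mpoly K[m]}),
     [/\ monomial_order le, reduced_groebner_basis le (toric_ideal A) G &
         f \in G]].

End ToricIdeals.

Arguments toric_ideal K {n m} A.
Arguments graver K {n m} A.
Arguments circuits K {n m} A.
Arguments universal_groebner K {n m} A.

(* Main.v *)
(** An integer configuration B is replaced by its Lawrence lifting A, with the columns
    (b_e, 1_e) and (0, 1_e).  The kernel of A consists of the vectors (d, -d) with d in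
    the kernel of B.  In the lifting every primitive binomial x^u - x^v is
    indispensable, u and v being the only monomials of their A-degree; hence it lies, up to
    sign, in each Markov basis and in each reduced Groebner basis.  So it is enough to
    find B with short circuits and with a long vector in its Graver basis.

    This B is the toric configuration of a graph: a complete binary tree of depth k made of
    triangles (odd cycles), glued at their vertices and closed by loops at the leaves and at
    the root.  A circuit joins two odd cycles by a path, so its length is linear in k.
    The closed walk through all edges has exponential length, and it is primitive:
    in a proper part of it, a parity argument starting from the leaves shows that each
    triangle is used either entirely or not at all. *)

Require Import Defs.
From mathcomp Require Import all_boot all_order all_algebra.
From mathcomp Require Import classical_sets reals.
From mathcomp Require Import mpoly.
From mathcomp Require Import boolp zify ring.

Set Implicit Arguments.
Unset Strict Implicit.
Unset Printing Implicit Defensive.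

Import Order.TTheory GRing.Theory Num.Theory.

Local Open Scope classical_set_scope.
Local Open Scope ring_scope.

(** * Binomials *)

Lemma leq1_of_pred_add (a b : nat) : (0 < a)%N -> (a + b).-1 = 1%N -> (b <= 1)%N.
Proof. lia. Qed.

Lemma leq1_of_pred_add_le (a b : nat) : (1 < b)%N -> ((a + b).-1 <= 2)%N -> (a <= 1)%N.
Proof. lia. Qed.

Lemma coef_linear1 (R : nzRingType) (a b : R) : ('X * a%:P - b%:P)`_1 = a.
Proof. by rewrite coefB coefXM !coefC subr0. Qed.

Lemma coef_linear0 (R : nzRingType) (a b : R) : ('X * a%:P - b%:P)`_0 = - b.
Proof. by rewrite coefB coefXM !coefC sub0r. Qed.

Section Binomials.
Variables (K : fieldType) (m : nat).
Implicit Types (f g h : {mpoly K[m]}) (u v w z : 'X_{1..m}).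

Lemma mcoeff_binom u v w :
  (binom K u v)@_w = (u == w)%:R - (v == w)%:R.
Proof. by rewrite /binom mcoeffB !mcoeffX. Qed.

Lemma mem_msupp_binom u v w : u != v ->
  (w \in msupp (binom K u v)) = (w == u) || (w == v).
Proof.
move=> uv; rewrite mcoeff_msupp mcoeff_binom [w == u]eq_sym [w == v]eq_sym.
case: (eqVneq u w) uv => [->|_] /= uv; first by rewrite [v == w]eq_sym (negbTE uv) subr0 oner_eq0.
by case: (eqVneq v w) => _; rewrite ?sub0r ?subr0 ?oppr_eq0 ?oner_eq0 ?eqxx.
Qed.

Lemma binom_neq0 u v : u != v -> binom K u v != 0.
Proof.
move=> uv; have := mem_msupp_binom u uv; rewrite eqxx /=; apply: contraTneq => ->.
by rewrite msupp0.
Qed.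

Lemma opp_binom u v : - binom K u v = binom K v u.
Proof. exact: opprB. Qed.

Lemma pdeg_binom u v : u != v -> pdeg (binom K u v) = maxn (mdeg u) (mdeg v).
Proof.
move=> uv; rewrite /pdeg.
rewrite (perm_big [:: u; v]) /=; first by rewrite big_cons big_seq1.
apply: uniq_perm => [|/=|w]; first exact: msupp_uniq.
  by rewrite inE uv.
by rewrite mem_msupp_binom // !inE.
Qed.

Lemma binomDr u v w : binom K (w + u) (w + v) = 'X_[w] * binom K u v.
Proof. by rewrite /binom mulrBr -!mpolyXD. Qed.

Lemma vars_binom u v i : u != v ->
  (i \in vars (binom K u v)) = (0 < u i)%N || (0 < v i)%N.
Proof.
move=> uv; rewrite inE; apply/hasP/orP => [[w]|].
  by rewrite mem_msupp_binom // => /orP[] /eqP ->; [left|right].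
by case=> H; [exists u|exists v]; rewrite ?mem_msupp_binom ?eqxx ?orbT.
Qed.

Lemma mpoly_unit_mcoeff0 f : f \is a GRing.unit -> f@_0%MM != 0.
Proof. by case/andP => _; rewrite unitfE. Qed.

Lemma binom_nonunit u v : u != v -> binom K u v \isn't a GRing.unit.
Proof.
move=> uv; apply/negP => /andP[/eqP E _].
have supp0 w : w \in msupp (binom K u v) -> w = 0%MM.
  by rewrite mcoeff_msupp E mcoeffC; case: (eqVneq w) => // _; rewrite mulr0 eqxx.
have u0 : u = 0%MM by apply: supp0; rewrite mem_msupp_binom // eqxx.
have v0 : v = 0%MM by apply: supp0; rewrite mem_msupp_binom // eqxx orbT.
by rewrite u0 v0 eqxx in uv.
Qed.

(** A common variable factors out, and neither it nor the remaining binomial is a unit. *)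
Lemma irreducible_binom_disjoint u v i : u != v ->
  irreducible_elt (binom K u v) -> ~~ ((u i != 0%N) && (v i != 0%N)).
Proof.
move=> uv [_ _ irr]; apply/negP => /andP[ui vi].
have := irr 'X_i (binom K (u - U_(i)) (v - U_(i))).
rewrite -binomDr ![(U_(i) + _)%MM]addmC !submK ?lep1mP // => /(_ erefl).
case=> [/mpoly_unit_mcoeff0|]; first by rewrite mcoeffX mnm1_eq0 eqxx.
apply/negP/binom_nonunit; apply: contraNneq uv => E.
by rewrite -(submK (m := U_(i)) (m' := u)) ?lep1mP // E submK ?lep1mP.
Qed.

(** [x^u - x^v] is a factor; for [p > 1] every term of the cofactor has positive degree, so the
    cofactor has no constant coefficient and is no unit either. *)
Lemma irreducible_binom_primitive u v p : u != v -> u != 0%MM -> v != 0%MM ->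
  irreducible_elt (binom K (u *+ p) (v *+ p)) -> (p <= 1)%N.
Proof.
move=> uv u0 v0 [_ _ H]; rewrite leqNgt; apply/negP => p1.
move: H; rewrite /binom -!mpolyXn subrXX => /(_ _ _ erefl).
case=> [|/mpoly_unit_mcoeff0]; first exact/negP/binom_nonunit.
rewrite raddf_sum big1 ?eqxx //= => i _.
rewrite !mpolyXn -mpolyXD mcoeffX -mdeg_eq0 mdegD !mdegMn addn_eq0 !muln_eq0 !mdeg_eq0.
rewrite (negbTE u0) (negbTE v0) /= subn_eq0 -ltnS prednK ?(ltnW p1) //.
rewrite -[(_ <= _)%N]andbT.
case: eqP => [->|]; rewrite ?andbF //.
by rewrite andbT leqNgt; case: p p1 {i} => [|[]].
Qed.

(* The substitution [x_j := t x_j] turns the degree in [x_j] into a degree in [t]. *)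
Definition grade j : {mpoly K[m]} -> {poly {mpoly K[m]}} :=
  mmap (polyC \o @mpolyC m K) (fun l => 'X^(l == j) * ('X_l)%:P).

Lemma gradeM j : {morph grade j : f g / f * g}.
Proof. exact: rmorphM. Qed.

Lemma gradeB j : {morph grade j : f g / f - g}.
Proof. exact: raddfB. Qed.

Lemma gradeX j u : grade j 'X_[u] = 'X^(u j) * ('X_[u])%:P.
Proof.
rewrite /grade mmapX /mmap1.
under eq_bigr do rewrite exprMn -exprM -rmorphXn.
rewrite big_split /= -rmorph_prod -mpolyXE_id; congr (_ * _).
rewrite (bigD1 j) //= eqxx mul1n big1 ?mulr1 // => l /negbTE ->.
by rewrite mul0n.
Qed.

Lemma coef_grade j f k u : (grade j f)`_k@_u = if u j == k then f@_u else 0.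
Proof.
rewrite {1}[f]mpolyE /grade raddf_sum /=.
under eq_bigr do rewrite mmapZ -[mmap _ _ _]/(grade j _) gradeX /=.
rewrite coef_sum raddf_sum /= [f in RHS]mpolyE [(\sum_(_ <- _) _)@_u]raddf_sum /=.
rewrite (big_morph (fun x : K => if u j == k then x else 0) (id1 := 0) (op1 := +%R)).
- apply: eq_bigr => w _; rewrite mulrCA -polyCM mulrC coefCM coefXn.
  rewrite mul_mpolyC mulr_natr mcoeffMn !mcoeffZ !mcoeffX.
  case: (eqVneq w u) => [->|_]; last by rewrite mulr0 mul0rn if_same.
  by rewrite mulr1 eq_sym; case: eqP.
- by move=> x y; case: ifP => //; rewrite addr0.
- by rewrite if_same.
Qed.


Lemma size_grade_le1 j f u : (size (grade j f) <= 1)%N -> u \in msupp f -> u j = 0%N.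
Proof.
move=> sz; rewrite mcoeff_msupp; apply: contraNeq => uj.
have := coef_grade j f (u j) u; rewrite eqxx => <-.
by rewrite nth_default ?mcoeff0 // (leq_trans sz) // lt0n.
Qed.

(** The coefficients form a domain, so degrees in [t] add up: a factor of a nonzero polynomial that
    is constant in [t] is constant in [t]. *)
Lemma size_grade_dvd j f g u : g * f = 'X_[u] -> u j = 0%N -> (size (grade j f) <= 1)%N.
Proof.
move=> E uj; have : grade j g * grade j f = ('X_[u])%:P.
  by rewrite -gradeM E gradeX uj mul1r.
have Xu0 : 'X_[u] != 0 :> {mpoly K[m]}.
  apply/eqP => /(congr1 (fun p : {mpoly K[m]} => p@_u)) /eqP.
  by rewrite mcoeffX eqxx mcoeff0 oner_eq0.
move=> P; have := congr1 (fun p : {poly _} => size p) P; rewrite size_polyC Xu0.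
have g0 : grade j g != 0.
  by apply: contraNneq Xu0 => g0; rewrite -polyC_eq0 -P g0 mul0r.
have f0 : grade j f != 0.
  by apply: contraNneq Xu0 => f0; rewrite -polyC_eq0 -P f0 mulr0.
rewrite (size_mul g0 f0) => S.
have g1 : (0 < size (grade j g))%N by rewrite size_poly_gt0.
exact: leq1_of_pred_add g1 S.
Qed.

(* [f = x_i a - b] has degree one in [x_i], so one factor does not involve [x_i];
   it divides both coefficients [a] and [b], which have no variable in common. *)
Lemma irreducible_binom_linear u v i : u i = 1%N -> v i = 0%N ->
  (forall j, (u j == 0%N) || (v j == 0%N)) -> irreducible_elt (binom K u v).
Proof.
move=> ui vi duv; have uv : u != v by apply/eqP => E; rewrite E vi in ui.
split; rewrite ?binom_neq0 ?binom_nonunit //.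
have gradeE : grade i (binom K u v) = 'X * ('X_[u])%:P - ('X_[v])%:P.
  by rewrite /binom gradeB !gradeX ui vi expr1 mul1r.
suff main g h : binom K u v = g * h -> (size (grade i h) <= 1)%N -> h \is a GRing.unit.
  move=> g h E.
  have sz : (size (grade i g * grade i h)%R <= 2)%N.
    rewrite -gradeM -E gradeE (leq_trans (size_polyD _ _)) // geq_max size_polyN.
    rewrite (leq_trans (size_polyC_leq1 _)) // andbT.
    apply: (leq_trans (size_polyMleq _ _)); rewrite size_polyX.
    exact: size_polyC_leq1.
  have [g0|g0] := eqVneq (grade i g) 0.
    by left; apply: (main h); rewrite 1?mulrC // g0 size_poly0.
  have [h0|h0] := eqVneq (grade i h) 0.
    by right; apply: (main g); rewrite // h0 size_poly0.
  move: sz; rewrite (size_mul g0 h0) => sz.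
  case: (leqP (size (grade i h)) 1) => szh; first by right; apply: (main g).
  left; apply: (main h); rewrite 1?mulrC //.
  exact: leq1_of_pred_add_le szh sz.
move=> E szh; set c := (grade i h)`_0.
have hE : grade i h = c%:P by exact: size1_polyC.
have ch : c = h.
  apply/mpolyP => w; rewrite /c coef_grade; case: eqP => // /eqP wi.
  by apply/esym/eqP; rewrite mcoeff_eq0; apply: contra wi => /(size_grade_le1 szh) ->.
have P : grade i g * h%:P = 'X * ('X_[u])%:P - ('X_[v])%:P.
  by rewrite -{1}ch -hE -gradeM -E gradeE.
have Eu : (grade i g)`_1 * h = 'X_[u].
  rewrite -coefMC P; exact: coef_linear1.
have Ev : - (grade i g)`_0 * h = 'X_[v].
  rewrite mulNr -coefMC P coef_linear0; exact: opprK.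
have supp0 w : w \in msupp h -> w = 0%MM.
  move=> hw; apply/mnmP => j; rewrite mnm0E.
  have /orP[/eqP|/eqP] := duv j => /size_grade_dvd H.
    exact: size_grade_le1 (H _ _ Eu) hw.
  exact: size_grade_le1 (H _ _ Ev) hw.
have hC : h = (h@_0%MM)%:MP.
  apply/mpolyP => w; rewrite mcoeffC; case: (eqVneq w 0%MM) => [->|w0].
    by rewrite mulr1.
  by rewrite mulr0; apply/eqP; rewrite mcoeff_eq0; apply: contra w0 => /supp0 ->.
apply/andP; split; first exact/eqP.
rewrite unitfE; apply: contraNneq (binom_neq0 uv) => h0.
by rewrite E hC h0 mulr0.
Qed.

End Binomials.

(** * Toric ideals and primitive pairs *)

(** Dickson's lemma, with a bound on minimal elements in place of their finiteness. Fix [p0] in [P]: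
    a [p] not above [p0] has some [p i < p0 i], so it lies in one of finitely many slices, each with
    one free coordinate fewer. *)
Lemma dickson (T : finType) (P : (T -> nat) -> Prop) :
  exists B, forall p, P p ->
    exists q, [/\ P q, forall i, (q i <= p i)%N & (\sum_i q i <= B)%N].
Proof.
(* [D] holds the coordinates in which elements of [P] may still differ; the induction is on its
   size. *)
suff main N : forall (D : {set T}) (P : (T -> nat) -> Prop), (#|D| < N)%N ->
    (forall p q, P p -> P q -> forall i, i \notin D -> p i = q i) ->
    exists B, forall p, P p ->
      exists q, [/\ P q, forall i, (q i <= p i)%N & (\sum_i q i <= B)%N].
  by apply: (main #|T|.+1 (setTfor T)); [rewrite cardsT | move=> p q _ _ i; rewrite inE].
elim: N => // N IH D {}P cardD agree.
have [[p0 Pp0]|noP] := pselect (exists p0, P p0); last first.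
  by exists 0%N => p Pp; case: noP; exists p.
have /choice [F HF] : forall ic : T * nat, exists B, ic.1 \in D ->
    forall p, P p -> p ic.1 = ic.2 ->
      exists q, [/\ P q, forall i, (q i <= p i)%N & (\sum_i q i <= B)%N].
  move=> [i c] /=; have [iD|_] := boolP (i \in D); last by exists 0%N.
  have [|p q [Pp pi] [Pq qi] j|B HB] := IH (D :\ i) (fun p => P p /\ p i = c).
  - by rewrite (cardsD1 i) iD in cardD.
  - rewrite !inE negb_and negbK => /orP[/eqP ->|jD]; first by rewrite pi qi.
    exact: agree.
  - exists B => _ p Pp pi; have [|q [[Pq _] qp sq]] := HB p; first by [].
    by exists q.
(* The bound covers [p0] itself and every slice [p i = c] with [c < p0 i]. *)
exists (\sum_i p0 i + \sum_i \sum_(c < p0 i) F (i, val c))%N => p Pp.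
have [/forallP le_p0|/forallPn [i]] := boolP [forall i, (p0 i <= p i)%N].
  by exists p0; split=> //; apply: leq_addr.
rewrite -ltnNge => lt_p.
have iD : i \in D by apply: contraTT lt_p => iD; rewrite -leqNgt (agree p0 p).
have [q [Pq qp sq]] := HF (i, p i) iD p Pp erefl.
exists q; split=> //; apply: (leq_trans sq); apply: leq_trans (leq_addl _ _).
rewrite (bigD1 i) //= (bigD1 (Ordinal lt_p)) //= -addnA.
exact: leq_addr.
Qed.

(** * Generated ideals and maximal degrees *)

Section Ideals.
Variable R : comNzRingType.
Implicit Types (S : set R) (f g : R).

Lemma mem_ideal_gen S f : S f -> ideal_gen S f.
Proof.
move=> Sf; exists 1%N, (fun=> 1), (fun=> f); split=> //.
by rewrite big_ord1 mul1r.
Qed.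

Lemma ideal_gen0 S : ideal_gen S 0.
Proof. by exists 0%N, (fun=> 0), (fun=> 0); split=> [[]|] //; rewrite big_ord0. Qed.

Lemma ideal_genD S f g : ideal_gen S f -> ideal_gen S g -> ideal_gen S (f + g).
Proof.
move=> [k [c [s [Ss ->]]]] [l [d [t [St ->]]]].
exists (k + l)%N, (fun i => match split i with inl i => c i | inr i => d i end),
  (fun i => match split i with inl i => s i | inr i => t i end); split.
  by move=> i; case: split.
rewrite big_split_ord; congr (_ + _); apply: eq_bigr => i _ /=.
  by case: splitP => [j /= ij|j /= ij]; [rewrite (ord_inj ij)|have := ltn_ord i; lia].
case: splitP => [j /= ij|j /= /addnI ij]; last by rewrite (ord_inj ij).
by have := ltn_ord j; lia.
Qed.

Lemma ideal_genM S f g : ideal_gen S g -> ideal_gen S (f * g).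
Proof.
move=> [k [c [s [Ss ->]]]]; exists k, (fun i => f * c i), s; split=> //.
by rewrite mulr_sumr; apply: eq_bigr => i _; rewrite mulrA.
Qed.

Lemma ideal_genN S f : ideal_gen S f -> ideal_gen S (- f).
Proof. by rewrite -mulN1r; apply: ideal_genM. Qed.

Lemma ideal_gen_sub S S' : S `<=` ideal_gen S' -> ideal_gen S `<=` ideal_gen S'.
Proof.
move=> SS' _ [k [c [s [Ss ->]]]].
elim/big_ind: _ => [|f g|i _]; first exact: ideal_gen0.
  exact: ideal_genD.
by apply/ideal_genM/SS'.
Qed.

End Ideals.

Lemma ideal_gen_monomials (K : fieldType) m (P : 'X_{1..m} -> Prop)
    (f : {mpoly K[m]}) w :
  ideal_gen [set 'X_[u] | u in P] f -> w \in msupp f -> exists2 u, P u & (u <= w)%MM.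
Proof.
move=> [k [c [g [Pg ->]]]].
rewrite mcoeff_msupp raddf_sum /= => /eqP nz.
have [i /eqP ci] : exists i, (c i * g i)@_w != 0.
  apply: contrapT => /forallNP H; apply: nz; rewrite big1 // => i _.
  by apply/eqP/negPn/negP/H.
have [u Pu gu] := Pg i; exists u => //.
move/eqP: ci; rewrite -gu -mcoeff_msupp (perm_mem (msuppMX _ _)).
by case/mapP => v _ ->; apply: lem_addr.
Qed.

Lemma ex_max_degree (K : fieldType) m (S : set {mpoly K[m]}) f B :
  S f -> (forall g, S g -> (pdeg g <= B)%N) ->
  exists2 d, is_max_degree S d & (pdeg f <= d)%N.
Proof.
move=> Sf SB.
have ex : exists d, `[< exists2 g, S g & pdeg g = d >].
  by exists (pdeg f); apply/asboolP; exists f.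
have ub d : `[< exists2 g, S g & pdeg g = d >] -> (d <= B)%N.
  by move=> /asboolP [g /SB gB <-].
exists (ex_maxn ex ub); case: ex_maxnP => d /asboolP H ubd.
  by split=> // g Sg; apply: ubd; apply/asboolP; exists g.
by apply: ubd; apply/asboolP; exists f.
Qed.

(** * Toric ideals of nonnegative configurations *)

Section Toric.
Variables (K : fieldType) (n m : nat) (A : 'I_m -> 'rV[int]_n).
Hypothesis A_ge0 : forall i j, 0 <= A i 0 j.
Implicit Types (f g : {mpoly K[m]}) (u v w z : 'X_{1..m}).

Lemma AdegreeD u v : Adegree A (u + v) = Adegree A u + Adegree A v.
Proof. by rewrite -big_split; apply: eq_bigr => i _; rewrite mnmDE mulrnDr. Qed.

Lemma Adegree_addm2l w u v :
  Adegree A (w + u) = Adegree A (w + v) <-> Adegree A u = Adegree A v.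
Proof. by rewrite !AdegreeD; split => [/addrI|->]. Qed.

Definition monomial_image u : 'X_{1..n} :=
  [multinom (\sum_i absz (A i 0%R j) * u i)%N | j < n].

Lemma Adegree_image u j : Adegree A u 0 j = (monomial_image u j)%:Z.
Proof.
rewrite summxE mnmE -[LHS]/(\sum_i _) (big_morph Posz PoszD (erefl _)).
apply: eq_bigr => i _.
by rewrite mulmxnE PoszM gez0_abs ?A_ge0 // -mulr_natr natz.
Qed.

Lemma monomial_imageP u v :
  monomial_image u = monomial_image v <-> Adegree A u = Adegree A v.
Proof.
split=> [E|/rowP E]; first by apply/rowP => j; rewrite !Adegree_image E.
by apply/mnmP => j; have := E j; rewrite !Adegree_image => -[].
Qed.

(** The monomial map [x_i -> t^(a_i)], whose kernel contains the toric ideal. Nonnegative entries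
    allow a polynomial ring as target instead of Laurent polynomials. *)
Definition toric_map : {mpoly K[m]} -> {mpoly K[n]} :=
  mmap (@mpolyC n K) (fun i => 'X_[[multinom absz (A i 0%R j) | j < n]]).

Lemma toric_mapM : {morph toric_map : f g / f * g}.
Proof. exact: rmorphM. Qed.

Lemma toric_mapB : {morph toric_map : f g / f - g}.
Proof. exact: raddfB. Qed.

Lemma toric_mapX u : toric_map 'X_[u] = 'X_[monomial_image u].
Proof.
rewrite /toric_map mmapX /mmap1.
under eq_bigr do rewrite mpolyXn.
rewrite mprodXE.
congr 'X_[_]; apply/mnmP => j; rewrite mnm_sumE mnmE; apply: eq_bigr => i _.
by rewrite mulmnE mnmE.
Qed.

Lemma toric_mapE f :
  toric_map f = \sum_(u <- msupp f) f@_u *: 'X_[monomial_image u].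
Proof.
apply: eq_bigr => u _.
by rewrite -toric_mapX /toric_map mmapX mul_mpolyC.
Qed.

Lemma toric_map_toric f : toric_ideal K A f -> toric_map f = 0.
Proof.
move=> [k [c [g [Hg ->]]]]; rewrite /toric_map raddf_sum big1 // => i _.
have [u [v [/monomial_imageP E ->]]] := Hg i.
by rewrite -[LHS]/(toric_map _) toric_mapM /binom toric_mapB !toric_mapX E subrr mulr0.
Qed.

(** [toric_map] adds up the coefficients of [f] over each fibre of the [A]-degree and sends [f] to
    0; a monomial alone in its fibre would leave its nonzero coefficient. *)
Lemma toric_fiber f u : toric_ideal K A f -> u \in msupp f ->
  exists v, [/\ v \in msupp f, v != u & Adegree A v = Adegree A u].
Proof.
move=> /toric_map_toric f0 uf; apply: contrapT => /forallNP H.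
have : (toric_map f)@_(monomial_image u) = f@_u.
  rewrite toric_mapE raddf_sum /= (bigD1_seq u) ?msupp_uniq //= big1_seq.
    by rewrite mcoeffZ mcoeffX eqxx mulr1 addr0.
  move=> v /andP[vu vf]; rewrite mcoeffZ mcoeffX.
  by case: eqP => [/monomial_imageP E|_]; [case: (H v)|rewrite mulr0].
by rewrite f0 mcoeff0 => /eqP; rewrite eq_sym mcoeff_eq0 uf.
Qed.

Lemma toric_binomP u v : toric_ideal K A (binom K u v) <-> Adegree A u = Adegree A v.
Proof.
split=> [|E]; last by apply: mem_ideal_gen; exists u, v.
have [-> //|uv] := eqVneq u v.
move=> I; have [|w] := @toric_fiber _ u I; first by rewrite mem_msupp_binom // eqxx.
by case=> [+ /negbTE wu E]; rewrite mem_msupp_binom // wu => /eqP <-.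
Qed.

(** The exponent condition of [graver] without irreducibility, hence independent of the field. *)
Definition primitive_pair u v : Prop :=
  [/\ u != v, Adegree A u = Adegree A v &
      forall w z, w != z -> Adegree A w = Adegree A z ->
        (w <= u)%MM -> (z <= v)%MM -> w = u /\ z = v].

Lemma primitive_pairC u v : primitive_pair u v -> primitive_pair v u.
Proof.
move=> [uv Auv H]; split; rewrite 1?eq_sym // => w z wz Awz wv zu.
by have [|//|//|//|-> ->] := H z w; rewrite 1?eq_sym.
Qed.

(** Cancelling a common variable would give a strictly smaller pair. *)
Lemma primitive_pair_disjoint u v i : primitive_pair u v ->
  (u i == 0%N) || (v i == 0%N).
Proof.
move=> [uv Auv H]; apply: contraT => /norP[ui vi].
have Eu : (U_(i) + (u - U_(i)))%MM = u by rewrite addmC submK ?lep1mP.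
have Ev : (U_(i) + (v - U_(i)))%MM = v by rewrite addmC submK ?lep1mP.
have [||||] := H (u - U_(i))%MM (v - U_(i))%MM; rewrite ?lem_subr //.
- by apply: contraNneq uv => E; rewrite -Eu -Ev E.
- by apply/(Adegree_addm2l U_(i)); rewrite Eu Ev.
- by move=> /(congr1 mdeg); rewrite -{2}Eu mdegD mdeg1; lia.
Qed.

(* Dickson's lemma for the pairs (u, v), seen as vectors in N^(2m). *)
Lemma primitive_pair_bounded :
  exists B, forall u v, primitive_pair u v -> (mdeg u <= B)%N /\ (mdeg v <= B)%N.
Proof.
pose fs (s : 'I_m + 'I_m -> nat) := [multinom s (inl i) | i < m].
pose sn (s : 'I_m + 'I_m -> nat) := [multinom s (inr i) | i < m].
have [B HB] := dickson (fun s => fs s != sn s /\ Adegree A (fs s) = Adegree A (sn s)).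
exists B => u v [uv Auv H].
pose s := fun i : 'I_m + 'I_m => match i with inl i => u i | inr i => v i end.
have su : fs s = u by apply/mnmP => i; rewrite mnmE.
have sv : sn s = v by apply/mnmP => i; rewrite mnmE.
have [|t [[t12 At] ts sB]] := HB s; first by rewrite su sv.
have [||Eu Ev] := H _ _ t12 At.
- by apply/mnm_lepP => i; rewrite mnmE; apply: (ts (inl i)).
- by apply/mnm_lepP => i; rewrite mnmE; apply: (ts (inr i)).
move: sB; rewrite big_sumType /= => sB.
have Du : mdeg u = (\sum_i t (inl i))%N.
  by rewrite -Eu mdegE; apply: eq_bigr => i _; rewrite mnmE.
have Dv : mdeg v = (\sum_i t (inr i))%N.
  by rewrite -Ev mdegE; apply: eq_bigr => i _; rewrite mnmE.
by rewrite Du Dv; split; apply: leq_trans sB; rewrite ?leq_addr ?leq_addl.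
Qed.

Lemma graver_primitive_pair f : graver K A f ->
  exists u v, f = binom K u v /\ primitive_pair u v.
Proof.
move=> [u [v [-> /(toric_binomP) Auv [nz _ _] H]]]; exists u, v; split=> //.
split=> // [|w z wz Awz wu zv]; first by apply: contraNneq nz => ->; rewrite /binom subrr.
by apply: H => //; apply/toric_binomP.
Qed.

Lemma primitive_pair_graver u v : primitive_pair u v ->
  irreducible_elt (binom K u v) -> graver K A (binom K u v).
Proof.
move=> [uv Auv H] irr; exists u, v; split=> //; first exact/toric_binomP.
by move=> w z wz /toric_binomP Awz; apply: H.
Qed.

Lemma toric_idealB f g :
  toric_ideal K A f -> toric_ideal K A g -> toric_ideal K A (f - g).
Proof. by move=> If /ideal_genN; apply: ideal_genD. Qed.

(** * Elements of a reduced Groebner basis *)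

Section UniversalGroebner.
Variables (le : rel 'X_{1..m}) (G : seq {mpoly K[m]}).
Hypotheses (le_order : monomial_order le)
  (G_red : reduced_groebner_basis le (toric_ideal K A) G).

Let standard v := forall g u, g \in G -> is_lead le g u -> ~~ (u <= v)%MM.

Lemma lead_standard f u : toric_ideal K A f -> is_lead le f u -> ~ standard u.
Proof.
move=> If lf std; have [[_ EG] _ _] := G_red.
have : initial_ideal le [set` G] 'X_[u].
  rewrite EG; apply: mem_ideal_gen; exists f, u; split=> //.
rewrite /initial_ideal.
rewrite [X in ideal_gen X](_ : _ =
  [set 'X_[w] | w in [set w | exists2 g, g \in G & is_lead le g w]]); last first.
  apply/seteqP; split=> [_ [g [w [gG lw ->]]]|_ [w [g gG lw] <-]].
    by exists w => //; exists g.
  by exists g, w.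
move=> /(@ideal_gen_monomials _ _ _ _ u); rewrite msuppX inE eqxx => /(_ erefl).
by move=> [w [g gG lw]] wu; have := std _ _ gG lw; rewrite wu.
Qed.

(** Otherwise the binomial of [u] and [v] lies in the ideal, and its leading monomial, one of the
    two, is standard. *)
Lemma standard_inj u v : standard u -> standard v -> Adegree A u = Adegree A v -> u = v.
Proof.
move=> su sv Auv; apply/eqP/negPn/negP => uv.
have [tot _ _ _ _] := le_order.
have lead w : (w == u) || (w == v) -> (le u w) -> (le v w) -> is_lead le (binom K u v) w.
  move=> wuv uw vw; split; first by rewrite mem_msupp_binom.
  by move=> z; rewrite mem_msupp_binom // => /orP[] /eqP ->.
have I : toric_ideal K A (binom K u v) by apply/toric_binomP.
have refl w : le w w by have := tot w w; rewrite orbb.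
case/orP: (tot u v) => luv.
  by apply: (@lead_standard _ v I) => //; apply: lead; rewrite ?eqxx ?orbT.
by apply: (@lead_standard _ u I) => //; apply: lead; rewrite ?eqxx.
Qed.

(** By reducedness the nonleading monomials of [g] are standard, so they lie in distinct fibres; as
    no monomial of [g] is alone in its fibre, exactly one of them exists, in the fibre of the
    leading monomial. *)
Lemma reduced_groebner_primitive_pair g : g \in G ->
  exists u v, g = binom K u v /\ primitive_pair u v.
Proof.
move=> gG; have [[GI EG] Glead Gred] := G_red.
have [tot anti trans le0 leD] := le_order.
have Ig : toric_ideal K A g by apply: GI.
have [u [lu gu]] := Glead g gG.
have le_dvd w z : (w <= z)%MM -> le w z.
  by move=> wz; have := leD _ _ w (le0 (z - w)%MM); rewrite add0m submK.
have std v : v \in msupp g -> v != u -> standard v.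
  move=> vg vu g' w g'G lw; have [E|g'g] := eqVneq g' g; last exact: (Gred g' g).
  apply: contra vu => /le_dvd wv; rewrite E in lw.
  have -> : v = w by apply: anti; rewrite lw.2.
  by apply/eqP/anti; rewrite lu.2 ?lw.2 //; [case: lu|case: lw].
have [v [vg vu Avu]] := toric_fiber Ig lu.1.
have only w : w \in msupp g -> w != u -> w = v.
  move=> wg wu; have [z [zg zw Azw]] := toric_fiber Ig wg.
  have [E|zu] := eqVneq z u.
    by apply: standard_inj; [exact: std|exact: std|rewrite Avu -E].
  by move: zw; rewrite (standard_inj (std _ zg zu) (std _ wg wu)) // eqxx.
have uv : u != v by rewrite eq_sym.
have Auv : Adegree A u = Adegree A v by [].
have E : g = binom K u v.
  (* The difference is supported on [v] alone, so by [toric_fiber] it is 0; this fixes the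
     coefficient of [x^v]. *)
  apply/eqP; rewrite -subr_eq0; apply/negPn/negP => nz.
  have Id : toric_ideal K A (g - binom K u v).
    by apply: toric_idealB => //; apply/toric_binomP.
  have sv w : w \in msupp (g - binom K u v) -> w = v.
    move=> wd; have [Ew|wu] := eqVneq w u.
      move: wd; rewrite Ew mcoeff_msupp mcoeffB gu mcoeff_binom eqxx.
      by rewrite eq_sym (negbTE vu) subr0 subrr eqxx.
    have /msuppB_le := wd; rewrite mem_cat mem_msupp_binom // (negbTE wu) /=.
    by case/orP => [/only|/eqP] ->.
  have [w [wd]] := toric_fiber Id (mlead_supp nz).
  by rewrite (sv _ wd) (sv _ (mlead_supp nz)) eqxx.
exists u, v; split=> //; split=> // w z wz Awz wu zv.
(* [z] divides the standard [v], so it is standard and [w] is not. Some leading monomial of [G] then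
   divides [w], hence [u], and by reducedness it can only be that of [g]. *)
have sz : standard z.
  by move=> g' t g'G lt; apply: contra (std v vg vu g' t g'G lt) => /lepm_trans; apply.
have nsw : ~ standard w by move=> sw; move: wz; rewrite (standard_inj sw sz) ?eqxx.
have [g' [t [g'G lt tw]]] : exists g' t, [/\ g' \in G, is_lead le g' t & (t <= w)%MM].
  apply: contrapT => H; apply: nsw => g' t g'G lt; apply/negP => tw.
  by apply: H; exists g', t.
have tu : (t <= u)%MM := lepm_trans tw wu.
have Eg' : g' = g.
  apply/eqP/negPn/negP => g'g; have := Gred g' g t u g'G gG g'g lt lu.1.
  by rewrite tu.
have Et : t = u.
  apply: anti; rewrite lu.2 /= -?Eg' ?lt.1 //.
  by apply: lt.2; rewrite Eg' lu.1.
have Ew : w = u by apply: anti; rewrite !le_dvd // -?Et.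
split=> //; apply: standard_inj => //; first exact: std.
by rewrite -Awz Ew.
Qed.

End UniversalGroebner.

End Toric.

(** * Construction of a reduced Groebner basis; indispensable binomials *)

Section RigidToric.
Variables (K : fieldType) (n m : nat) (A : 'I_m -> 'rV[int]_n).
Hypothesis A_ge0 : forall i j, 0 <= A i 0 j.
Implicit Types (f g : {mpoly K[m]}) (u v w z : 'X_{1..m}).

(** The standard monomials of the order [<=], described as least in their fibres so that they are
    available before any Groebner basis. *)
Definition standard u := forall v, Adegree A v = Adegree A u -> (u <= v)%O.

Lemma standard_unique u v :
  standard u -> standard v -> Adegree A u = Adegree A v -> u = v.
Proof. by move=> su sv Auv; apply/le_anti; rewrite su ?sv. Qed.

Lemma standard_dvd u v : (u <= v)%MM -> standard v -> standard u.
Proof.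
move=> uv sv w Aw; have := sv (v - u + w)%MM.
rewrite -{2 3}(submK uv) lemc_add2r; apply.
exact/Adegree_addm2l.
Qed.

Lemma ex_standard u : exists2 v, standard v & Adegree A v = Adegree A u.
Proof.
elim/(@ltmwf m): u => u IH; have [su|] := pselect (standard u); first by exists u.
move=> /existsNP [v /not_implyP [Av /negP]]; rewrite -ltNge => /IH [w sw Aw].
by exists w => //; rewrite Aw.
Qed.

(** These are the minimal generators of the initial ideal. *)
Definition minimal_nonstandard u :=
  ~ standard u /\ forall w, (w <= u)%MM -> ~ standard w -> w = u.

Lemma ex_minimal_nonstandard u : ~ standard u ->
  exists2 w, minimal_nonstandard w & (w <= u)%MM.
Proof.
elim/(@ltmwf m): u => u IH nsu.
have [H|] := pselect (forall w, (w <= u)%MM -> ~ standard w -> w = u).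
  by exists u => //; apply: lepm_refl.
move=> /existsNP [w /not_implyP [wu /not_implyP [nsw /eqP nwu]]].
have [|z mz zw] := IH w _ nsw; first by rewrite lt_neqAle nwu lem_leo.
by exists z => //; apply: lepm_trans wu.
Qed.

(** A standard [w] would equal the standard [z]; so [w] is nonstandard, and minimality of [u] forces
    [w = u]. *)
Lemma minimal_nonstandard_primitive_pair u v : minimal_nonstandard u ->
  standard v -> Adegree A u = Adegree A v -> primitive_pair A u v.
Proof.
move=> [nsu minu] sv Auv; split=> // [|w z wz Awz wu zv].
  by apply: contra_not_neq nsu => ->.
have sz := standard_dvd zv sv.
have Ew : w = u.
  by apply: minu => // sw; move: wz; rewrite (standard_unique sw sz) ?eqxx.
by split=> //; apply: standard_unique => //; rewrite -Awz Ew.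
Qed.

Let le : rel 'X_{1..m} := fun u v => (u <= v)%O.

Lemma le_monomial_order : monomial_order le.
Proof.
split; rewrite /le.
- exact: le_total.
- exact: le_anti.
- exact: le_trans.
- exact: le0m.
- by move=> u v w; rewrite lemc_add2l.
Qed.

Lemma is_lead_binom u v w : (v < u)%O -> is_lead le (binom K u v) w <-> w = u.
Proof.
move=> vu; have uv : u != v by rewrite neq_lt vu orbT.
split=> [[+ lw]|->].
  rewrite mem_msupp_binom // => /orP[/eqP //|/eqP E].
  have := lw u; rewrite mem_msupp_binom // eqxx => /(_ erefl).
  by rewrite /le E leNgt vu.
split=> [|z]; rewrite mem_msupp_binom ?eqxx //.
by case/orP => /eqP ->; rewrite /le // ltW.
Qed.

Lemma ex_reduced_groebner_basis : exists2 G,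
  reduced_groebner_basis le (toric_ideal K A) G &
  forall u v, minimal_nonstandard u -> standard v -> Adegree A u = Adegree A v ->
    binom K u v \in G.
Proof.
have [B HB] := primitive_pair_bounded A.
(* The pairs in question are primitive, so the bound [B] places their exponents in a finite type
   that can be enumerated. *)
pose good (p : 'X_{1..m < B.+1} * 'X_{1..m < B.+1}) :=
  `[< [/\ minimal_nonstandard p.1, standard p.2 & Adegree A p.1 = Adegree A p.2] >].
pose G := [seq binom K (val p.1) (val p.2) | p <- enum good].
have GI u v : minimal_nonstandard u -> standard v -> Adegree A u = Adegree A v ->
    binom K u v \in G.
  move=> mu sv Auv; have [uB vB] := HB _ _ (minimal_nonstandard_primitive_pair mu sv Auv).
  rewrite -ltnS in uB; rewrite -ltnS in vB.
  apply/mapP; exists (BMultinom uB, BMultinom vB) => //.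
  by rewrite mem_enum; apply/asboolP.
have GE g : g \in G -> exists u v, [/\ g = binom K u v, minimal_nonstandard u,
    standard v, Adegree A u = Adegree A v & (v < u)%O].
  move=> /mapP [p]; rewrite mem_enum => /asboolP [mu sv Auv] ->.
  exists (val p.1), (val p.2); split=> //; rewrite lt_neqAle sv // andbT.
  by apply: contra_not_neq mu.1 => <-.
exists G => //; split.
- have Gtoric : [set` G] `<=` toric_ideal K A.
    by move=> g /GE [u [v [-> _ _ Auv _]]]; apply/toric_binomP.
  split=> //; apply/seteqP; split; apply: ideal_gen_sub.
    move=> _ [g [u [gG lu ->]]]; apply: mem_ideal_gen.
    by exists g, u; split=> //; apply: Gtoric.
  move=> _ [f [u [If lu ->]]].
  (* A standard [u] would be at most the other monomial [v] of [f] in its fibre, whereas [v <= u]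
     because [u] leads. *)
  have nsu : ~ standard u.
    move=> su; have [v [vf vu Av]] := toric_fiber A_ge0 If lu.1.
    by move: vu; rewrite eq_le (su _ Av) andbT => /negP; apply; apply: lu.2.
  have [w mw wu] := ex_minimal_nonstandard nsu.
  have [v sv Av] := ex_standard w.
  rewrite -(submK wu) mpolyXD; apply/ideal_genM/mem_ideal_gen.
  exists (binom K w v), w; split=> //; first exact: GI.
  apply/is_lead_binom => //; rewrite lt_neqAle sv // andbT.
  by apply: contra_not_neq mw.1 => <-.
- move=> g /GE [u [v [-> mu sv Auv vu]]]; exists u; split; first exact/is_lead_binom.
  by rewrite mcoeff_binom eqxx lt_eqF // subr0.
- move=> g g' w z /GE [u [v [-> mu sv Auv vu]]] /GE [u' [v' [-> mu' sv' Auv' vu']]] gg'.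
  move=> /(is_lead_binom _ vu) ->.
  rewrite mem_msupp_binom; last by rewrite neq_lt vu' orbT.
  case/orP => /eqP ->; apply/negP => le_u.
    have E := mu'.2 _ le_u mu.1; move: gg'.
    by rewrite E (standard_unique sv sv') ?eqxx // -Auv -Auv' E.
  exact/mu.1/(standard_dvd le_u).
Qed.

(** Indispensability of primitive binomials; [lawrence_rigid] establishes it for Lawrence
    liftings. *)
Hypothesis rigid : forall u v, primitive_pair A u v ->
  forall w, Adegree A w = Adegree A u -> w = u \/ w = v.

(** [u] is minimal nonstandard: if [w] divides [u] and some [z < w] is in the fibre of [w],
    replacing [w] by [z] moves [u] inside its fibre, hence to [v]. Then [u - w] divides both [u] and
    [v], whose supports are disjoint, so [w = u]. *)
Lemma primitive_pair_universal u v : primitive_pair A u v -> (v < u)%O ->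
  universal_groebner K A (binom K u v).
Proof.
move=> P vu; have [uv Auv _] := P.
have [G redG inG] := ex_reduced_groebner_basis.
exists le, G; split=> //; first exact: le_monomial_order.
apply: inG => //.
  split=> [su|w wu]; first by have := su v; rewrite leNgt vu => /(_ (esym Auv)).
  move=> /existsNP [z /not_implyP [Az /negP]]; rewrite -ltNge => zw.
  have [||E] := rigid P (w := (u - w + z)%MM).
  - rewrite -[in RHS](submK wu); exact/Adegree_addm2l.
  - by rewrite -[in RHS](submK wu) => /addmI E; rewrite E ltxx in zw.
  - apply/mnmP => i; have := primitive_pair_disjoint i P.
    by rewrite -E mnmDE mnmBE; move/mnm_lepP/(_ i): wu; lia.
by move=> w; rewrite -Auv => /(rigid P) [] -> //; apply: ltW.
Qed.

(** The orientation [v < u] keeps one of the two opposite binomials of each pair, as minimality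
    under inclusion requires. *)
Definition primitive_binomials : set {mpoly K[m]} :=
  [set f | exists u v, [/\ primitive_pair A u v, (v < u)%O & f = binom K u v]].

(** A smaller pair [(w, z)] splits a nonprimitive binomial as [x^u - x^v = x^(u-w) (x^w - x^z) + x^z
    (x^(u-w) - x^(v-z))], and both new pairs have smaller total degree. *)
Lemma primitive_binomials_generate :
  ideal_gen primitive_binomials = toric_ideal K A.
Proof.
apply/seteqP; split; apply: ideal_gen_sub.
  move=> _ [u [v [[_ Auv _] _ ->]]]; exact/toric_binomP.
move=> _ [u [v [Auv ->]]].
have [N] := ubnP (mdeg u + mdeg v)%N; elim: N u v Auv => // N IH u v Auv duv.
have [->|uv] := eqVneq u v; first by rewrite /binom subrr; apply: ideal_gen0.
have [P|] := pselect (primitive_pair A u v).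
  case/orP: (le_total u v); rewrite le_eqVlt ?[v == u]eq_sym (negbTE uv) /= => lt.
    rewrite -opp_binom; apply/ideal_genN/mem_ideal_gen; exists v, u; split=> //.
    exact: primitive_pairC.
  by apply: mem_ideal_gen; exists u, v.
move=> NP; have [w [z [wz Awz wu zv nwz]]] : exists w z, [/\ w != z,
    Adegree A w = Adegree A z, (w <= u)%MM, (z <= v)%MM & ~ (w = u /\ z = v)].
  apply: contrapT => H; apply: NP; split=> // w z wz Awz wu zv.
  by apply: contrapT => nwz; apply: H; exists w, z.
have -> : binom K u v = 'X_[u - w] * binom K w z + 'X_[z] * binom K (u - w) (v - z).
  rewrite -!binomDr [(z + (u - w))%MM]addmC [(z + (v - z))%MM]addmC !submK //.
  by rewrite /binom addrA subrK.
have du := congr1 mdeg (submK wu); have dv := congr1 mdeg (submK zv).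
rewrite !mdegD in du dv.
apply: ideal_genD; apply: ideal_genM; apply: IH => //.
- suff : (0 < mdeg (u - w) + mdeg (v - z))%N by lia.
  rewrite lt0n; apply/negP; rewrite addn_eq0 !mdeg_eq0 => /andP[/eqP uw /eqP vz].
  by apply: nwz; rewrite -(submK wu) -(submK zv) uw vz !add0m.
- apply/(Adegree_addm2l _ w); rewrite [in RHS]AdegreeD Awz -AdegreeD.
  by rewrite ![(_ + (_ - _))%MM]addmC !submK.
- suff : (0 < mdeg w + mdeg z)%N by lia.
  rewrite lt0n; apply: contraNN wz; rewrite addn_eq0 !mdeg_eq0 => /andP[/eqP -> /eqP ->].
  by [].
Qed.

(** For minimality: [x^u] occurs in some [c i * g i], so [u = t + w] or [u = t + z]. Exchanging [w]
    and [z] there stays in the fibre and gives [v], and [t = 0] by disjointness. So [g i] is the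
    binomial up to sign, and the orientation fixes the sign. *)
Lemma markov_primitive_binomials : markov_basis A primitive_binomials.
Proof.
split; first by move=> _ [u [v [[uv _ _] _ ->]]]; exists u, v.
  exact: primitive_binomials_generate.
move=> M' M'M genM'; apply/seteqP; split=> // _ [u [v [P vu ->]]].
have [uv Auv _] := P.
have : ideal_gen M' (binom K u v) by rewrite genM'; apply/toric_binomP.
move=> [k [c [g [gM' E]]]].
have [i ci] : exists i, (c i * g i)@_u != 0.
  apply: contrapT => /forallNP H; have /eqP := mcoeff_binom K u v u.
  rewrite {1}E raddf_sum big1 /= => [|i _]; last exact/eqP/negPn/negP/H.
  by rewrite eqxx [v == u]eq_sym (negbTE uv) subr0 eq_sym oner_eq0.
have [w [z [[wz Awz _] zw Eg]]] := M'M _ (gM' i).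
suff [Ew Ez] : w = u /\ z = v by rewrite -Ew -Ez -Eg.
have disj t x y : (t + x)%MM = u -> (t + y)%MM = v -> t = 0%MM.
  move=> Eu Ev; apply/mnmP => j; have := primitive_pair_disjoint j P.
  by rewrite -Eu -Ev !mnmDE mnm0E; lia.
move: ci; rewrite Eg /binom mulrBr -mcoeff_msupp => /msuppB_le.
rewrite mem_cat !(perm_mem (msuppMX _ _)) => /orP[] /mapP [t _ Et].
  have [||Ev] := rigid P (w := (t + z)%MM).
  - by rewrite Et ![(_ + t)%MM]addmC; apply/Adegree_addm2l.
  - by rewrite Et [(w + t)%MM]addmC => /addmI Ezw; rewrite Ezw ltxx in zw.
  - rewrite addmC in Et; have t0 := disj _ _ _ (esym Et) Ev.
    by rewrite Et -Ev t0 !add0m.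
have [||Ev] := rigid P (w := (t + w)%MM).
- by rewrite Et ![(_ + t)%MM]addmC; apply/Adegree_addm2l.
- by rewrite Et [(z + t)%MM]addmC => /addmI Ezw; rewrite Ezw ltxx in zw.
- rewrite addmC in Et; have t0 := disj _ _ _ (esym Et) Ev.
  move: vu; rewrite -Ev Et t0 !add0m => wz'.
  by have := lt_trans zw wz'; rewrite ltxx.
Qed.

End RigidToric.

(** * Lawrence liftings *)

Section Lawrence.
Variables (E V : finType) (B : V -> E -> int).

Definition in_kernel (d : E -> int) := forall v, \sum_e B v e * d e = 0.

(* The entries are shifted by 2, i.e. by twice the sum of the rows of the second kind: this
   makes them nonnegative for the B used below and does not change the kernel. *)
Definition lawrence (i : 'I_#|{: E * bool}|) : 'rV[int]_#|{: V + E}| :=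
  \row_j match enum_val j with
         | inl v => (if (enum_val i).2 then B v (enum_val i).1 else 0) + 2
         | inr e => ((enum_val i).1 == e)%:R
         end.

Local Notation mon := 'X_{1..#|{: E * bool}|}.
Implicit Types (u v w z : mon) (d : E -> int).

(** [b] chooses between the column [(b_e, 1_e)], for [true], and the column [(0, 1_e)]. *)
Definition expo u e b : nat := u (enum_rank (e, b)).

Lemma eq_expo u v : (forall e b, expo u e b = expo v e b) -> u = v.
Proof.
move=> H; apply/mnmP => i; rewrite -(enum_valK i).
by case: (enum_val i) => e b; apply: H.
Qed.

Lemma lem_expo u v : (forall e b, (expo u e b <= expo v e b)%N) -> (u <= v)%MM.
Proof.
move=> H; apply/mnm_lepP => i; rewrite -(enum_valK i).
by case: (enum_val i) => e b; apply: H.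
Qed.

Lemma sum_expo (R : nmodType) (F : 'I_#|{: E * bool}| -> R) :
  \sum_i F i = \sum_e (F (enum_rank (e, true)) + F (enum_rank (e, false))).
Proof.
rewrite (reindex enum_rank); last by apply: onW_bij; apply: enum_rank_bij.
rewrite (eq_bigr (fun p => F (enum_rank (p.1, p.2)))); last by case.
rewrite -(pair_bigA _ (fun e b => F (enum_rank (e, b)))) /=.
by apply: eq_bigr => e _; rewrite big_bool.
Qed.

Lemma lawrence_row u e :
  Adegree lawrence u 0 (enum_rank (inr e)) = (expo u e true + expo u e false)%:Z.
Proof.
rewrite summxE sum_expo (bigD1 e) //= big1 => [|e' e'e].
  by rewrite !mulmxnE !mxE !enum_rankK /= eqxx !natz addr0 PoszD.
by rewrite !mulmxnE !mxE !enum_rankK /= (negbTE e'e) !mul0rn addr0.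
Qed.

Lemma base_row u x :
  Adegree lawrence u 0 (enum_rank (inl x)) = \sum_e B x e * (expo u e true)%:Z +
    2 * \sum_e (expo u e true + expo u e false)%:Z.
Proof.
rewrite summxE sum_expo mulr_sumr -big_split; apply: eq_bigr => e _ /=.
have natZ (a : int) k : a *+ k = a * k%:Z by rewrite -mulr_natr natz.
rewrite !mulmxnE !mxE !enum_rankK /= !natZ -/(expo u e true) -/(expo u e false).
by rewrite PoszD; ring.
Qed.

(** Once the rows of the second kind agree, so do the shifts by 2, and they cancel in the rows of
    the first kind. *)
Lemma lawrenceP u v : Adegree lawrence u = Adegree lawrence v <->
  (forall e, (expo u e true + expo u e false = expo v e true + expo v e false)%N) /\
  in_kernel (fun e => (expo u e true)%:Z - (expo v e true)%:Z).
Proof.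
split=> [/rowP H|[H ker]].
  have Hs e : (expo u e true + expo u e false = expo v e true + expo v e false)%N.
    by have := H (enum_rank (inr e)); rewrite !lawrence_row => -[].
  split=> // x; have := H (enum_rank (inl x)); rewrite !base_row.
  under [X in _ + 2 * X = _]eq_bigr do rewrite Hs.
  move/addIr => Ex; under eq_bigr do rewrite mulrBr.
  by rewrite sumrB Ex subrr.
apply/rowP => j; rewrite -(enum_valK j); case: (enum_val j) => [x|e].
  rewrite !base_row; under [X in _ + 2 * X = _]eq_bigr do rewrite H.
  congr (_ + _); apply/eqP; rewrite -subr_eq0 -sumrB -[X in _ == X](ker x).
  by apply/eqP; apply: eq_bigr => e _; rewrite mulrBr.
by rewrite !lawrence_row H.
Qed.

(* The exponents of the monomial with the positive part of the vector (d, -d). *)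
Definition lift_monomial d : mon :=
  [multinom absz (Num.max (if (enum_val i).2 then d (enum_val i).1
                           else - d (enum_val i).1) 0) | i < _].

Lemma expo_lift d e b :
  expo (lift_monomial d) e b = absz (Num.max (if b then d e else - d e) 0).
Proof. by rewrite /expo mnmE enum_rankK. Qed.

(** Negating [d] exchanges the positive and the negative part of [(d, -d)]. *)
Definition lift_opp d := lift_monomial (fun e => - d e).

Lemma lift_fiber d : in_kernel d ->
  Adegree lawrence (lift_monomial d) = Adegree lawrence (lift_opp d).
Proof.
move=> ker; apply/lawrenceP; split=> [e|x]; rewrite ?expo_lift; first by lia.
rewrite -[RHS](ker x); apply: eq_bigr => e _; congr (_ * _).
by rewrite !expo_lift; lia.
Qed.

Lemma lift_neq d : (exists e, d e != 0) -> lift_monomial d != lift_opp d.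
Proof.
move=> [e de]; apply: contra_neq de => /(congr1 (fun u => expo u e true)).
by rewrite !expo_lift; lia.
Qed.

Lemma lift_disjoint d i : (lift_monomial d i == 0%N) || (lift_opp d i == 0%N).
Proof. by rewrite !mnmE; case: ifP => _; lia. Qed.

Lemma mdeg_lift d : mdeg (lift_monomial d) = (\sum_e absz (d e))%N.
Proof.
rewrite mdegE; rewrite (sum_expo (fun i => lift_monomial d i)).
by apply: eq_bigr => e _; rewrite -/(expo _ e true) -/(expo _ e false) !expo_lift; lia.
Qed.

Lemma mdeg_lift_opp d : mdeg (lift_opp d) = (\sum_e absz (d e))%N.
Proof. by rewrite mdeg_lift; apply: eq_bigr => e _; rewrite abszN. Qed.

Lemma disjoint_fiber_lift u v : Adegree lawrence u = Adegree lawrence v ->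
  (forall i, (u i == 0%N) || (v i == 0%N)) ->
  let d e := (expo u e true)%:Z - (expo v e true)%:Z in
  u = lift_monomial d /\ v = lift_opp d.
Proof.
move=> /lawrenceP [S _] D d.
have De e b : (expo u e b == 0%N) || (expo v e b == 0%N) := D (enum_rank (e, b)).
split; apply: eq_expo => e b; rewrite expo_lift /d;
  have := S e; have := De e true; have := De e false; case: b; lia.
Qed.

(** Write [w = u + (d, -d)]. The negative part of [(d, -d)] divides [u] because [w] is nonnegative;
    the positive part divides [v] because [u] and [v] are disjoint with equal sums over each [e]. If
    [d] is nonzero, primitivity turns both into equalities, so [w = v]. *)
Lemma lawrence_rigid u v : primitive_pair lawrence u v ->
  forall w, Adegree lawrence w = Adegree lawrence u -> w = u \/ w = v.
Proof.
move=> P w /lawrenceP [Sw kw]; have [uv Auv H] := P.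
have [Suv kuv] := (lawrenceP u v).1 Auv.
have D e b : (expo u e b == 0%N) || (expo v e b == 0%N).
  exact: primitive_pair_disjoint P.
pose d e := (expo w e true)%:Z - (expo u e true)%:Z.
have [/forallP d0|/forallPn [e0 de0]] := boolP [forall e, d e == 0].
  left; apply: eq_expo => e b; have /eqP := d0 e; have := Sw e.
  by rewrite /d; case: b; lia.
right.
have [||||Eu Ev] := H (lift_opp d) (lift_monomial d).
- by rewrite eq_sym; apply: lift_neq; exists e0.
- by apply/esym/lift_fiber.
- apply: lem_expo => e b; rewrite expo_lift /d; have := Sw e; have := Suv e.
  have := D e true; have := D e false.
  by case: b; lia.
- apply: lem_expo => e b; rewrite expo_lift /d; have := Sw e; have := Suv e.
  have := D e true; have := D e false.
  by case: b; lia.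
apply: eq_expo => e b.
have := congr1 (fun u => expo u e b) Eu; have := congr1 (fun u => expo u e b) Ev.
rewrite !expo_lift /d; have := Sw e; have := Suv e.
have := D e true; have := D e false.
by case: b; lia.
Qed.

End Lawrence.

(** A vector with coprime entries is the shortest integral one on its ray: if [x i0 / y i0] reduces
    to [a / b], then [a] divides all entries of [x], so [a = 1]. *)
Lemma leq_coprime_proportional (I : Type) (x y : I -> nat) i0 :
  (0 < x i0)%N -> (0 < y i0)%N -> (forall i, y i0 * x i = x i0 * y i)%N ->
  (forall p, (0 < p)%N -> (forall i, (p %| x i)%N) -> (p <= 1)%N) ->
  forall i, (x i <= y i)%N.
Proof.
move=> x0 y0 xy prim i; set g := gcdn (x i0) (y i0).
have g0 : (0 < g)%N by rewrite gcdn_gt0 x0.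
have [a Ea] : exists a, x i0 = (a * g)%N by apply/dvdnP/dvdn_gcdl.
have [b Eb] : exists b, y i0 = (b * g)%N by apply/dvdnP/dvdn_gcdr.
have cab : coprime a b.
  by rewrite /coprime -(eqn_pmul2r g0) muln_gcdl -Ea -Eb mul1n.
have Exy j : (b * x j = a * y j)%N.
  by apply/eqP; rewrite -(eqn_pmul2r g0) mulnAC -Eb xy Ea mulnAC.
have a0 : (0 < a)%N by move: x0; rewrite Ea muln_gt0 => /andP[].
have b0 : (0 < b)%N by move: y0; rewrite Eb muln_gt0 => /andP[].
have a1 : a = 1%N.
  apply/eqP; rewrite eqn_leq a0 andbT; apply: prim => // j.
  by rewrite -(Gauss_dvdr _ cab) Exy dvdn_mulr.
by have := Exy i; rewrite a1 mul1n => <-; rewrite leq_pmull.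
Qed.

(** * Degrees in a Lawrence lifting *)

Section LawrenceDegrees.
Variables (K : fieldType) (E V : finType) (B : V -> E -> int).
Local Notation mon := 'X_{1..#|{: E * bool}|}.
Implicit Types (u v w z : mon) (d : E -> int).

Lemma lawrence_ge0 : (forall x e, -2 <= B x e) -> forall i j, 0 <= lawrence B i 0 j.
Proof.
move=> B_ge i j; rewrite mxE; case: (enum_val j) => [x|e]; last exact: ler0n.
by have := B_ge x (enum_val i).1; case: ifP => _; lia.
Qed.

Lemma lawrence_inj : (forall e, exists x, B x e != 0) -> injective (lawrence B).
Proof.
move=> B_neq0 i i' /rowP H; apply: enum_val_inj.
case Ei: (enum_val i) => [e b]; case Ei': (enum_val i') => [e' b'].
have := H (enum_rank (inr e')); rewrite !mxE enum_rankK Ei Ei' /= eqxx.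
case: eqP => // Ee _; subst e'; have [x /eqP Bx] := B_neq0 e.
have := H (enum_rank (inl x)); rewrite !mxE enum_rankK Ei Ei' /= => /addIr.
by case: b b' {Ei Ei'} => [] [] // E'; case: Bx.
Qed.

Hypothesis B_ge : forall x e, -2 <= B x e.
Local Notation A := (lawrence B).
Let A_ge0 := lawrence_ge0 B_ge.

Lemma kernel_scale_sub d d' (a b : int) : in_kernel B d -> in_kernel B d' ->
  in_kernel B (fun e => a * d e - b * d' e).
Proof.
move=> kd kd' x.
transitivity (a * (\sum_e B x e * d e) - b * (\sum_e B x e * d' e)).
  by rewrite !mulr_sumr -sumrB; apply: eq_bigr => e _; ring.
by rewrite kd kd' !mulr0 subrr.
Qed.

Lemma vars_lift d i : (exists e, d e != 0) ->
  (i \in vars (binom K (lift_monomial d) (lift_opp d))) = (d (enum_val i).1 != 0).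
Proof.
move=> /lift_neq uv; rewrite vars_binom //.
rewrite -(enum_valK i); case: (enum_val i) => e b; rewrite enum_rankK /=.
rewrite -/(expo (lift_monomial d) e b) -/(expo (lift_opp d) e b) !expo_lift.
by case: b; lia.
Qed.

Lemma pdeg_lift d : (exists e, d e != 0) ->
  pdeg (binom K (lift_monomial d) (lift_opp d)) = (\sum_e absz (d e))%N.
Proof. by move=> /lift_neq uv; rewrite pdeg_binom // mdeg_lift mdeg_lift_opp maxnn. Qed.

Lemma lift_toric d : in_kernel B d ->
  toric_ideal K A (binom K (lift_monomial d) (lift_opp d)).
Proof. by move=> kd; apply/toric_binomP => //; apply: lift_fiber. Qed.

Lemma circuit_lift f : circuits K A f -> exists d,
  [/\ in_kernel B d, exists e, d e != 0 & f = binom K (lift_monomial d) (lift_opp d)].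
Proof.
move=> [[u [v [uv ->]]] /(toric_binomP _ A_ge0) Auv irr _].
have D i : (u i == 0%N) || (v i == 0%N).
  by have := irreducible_binom_disjoint i uv irr; rewrite negb_and !negbK.
have := disjoint_fiber_lift Auv D; set d := fun e => _ - _; move=> /= [Eu Ev].
exists d; split.
- by have [_] := (lawrenceP B u v).1 Auv.
- apply: contrapT => /forallNP H; move: uv; rewrite Eu Ev => /eqP; apply.
  apply: eq_expo => e b; rewrite !expo_lift.
  by have /negP := H e; rewrite negbK => /eqP ->; rewrite !oppr0.
- by rewrite -Eu -Ev.
Qed.

Lemma irreducible_lift_primitive d p : (exists e, d e != 0) ->
  irreducible_elt (binom K (lift_monomial d) (lift_opp d)) ->
  (0 < p)%N -> (forall e, (p %| absz (d e))%N) -> (p <= 1)%N.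
Proof.
move=> nz irr p0 pd.
pose q (u : mon) : mon := [multinom (u i %/ p)%N | i < _].
have pmax (x : int) : (p %| absz x)%N -> (p %| absz (Num.max x 0))%N.
  by move=> px; rewrite maxEle; case: ifP; rewrite ?dvdn0.
have qE : (q (lift_monomial d) *+ p)%MM = lift_monomial d.
  apply/mnmP => i; rewrite mulmnE !mnmE divnK //; apply: pmax.
  by case: ifP => _; rewrite ?abszN.
have qE' : (q (lift_opp d) *+ p)%MM = lift_opp d.
  apply/mnmP => i; rewrite mulmnE !mnmE divnK //; apply: pmax.
  by case: ifP => _; rewrite ?abszN.
have nz' : (0 < \sum_e absz (d e))%N.
  have [e de] := nz; rewrite (bigD1 e) //= ltn_addr // lt0n absz_eq0 //.
have q0 (u : mon) : (q u *+ p)%MM = u -> (0 < mdeg u)%N -> q u != 0%MM.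
  by move=> Eu; apply: contraTneq => qu0; rewrite -Eu qu0 mdegMn mdeg0.
apply: (@irreducible_binom_primitive K _ (q (lift_monomial d)) (q (lift_opp d))).
- by apply: contraNneq (lift_neq nz) => Eq; rewrite -qE Eq qE'.
- by apply: q0 => //; rewrite mdeg_lift.
- by apply: q0 => //; rewrite mdeg_lift_opp.
- by rewrite qE qE'.
Qed.

(** [d'] is proportional to [d]: otherwise [d' e0 * d - d e0 * d'] is a nonzero kernel vector of
    smaller support, as it vanishes at [e0]. Irreducibility makes the entries of [d] coprime, so [d]
    is no longer than [d']. *)
Lemma circuit_degree_le (C : nat) :
  (forall d, in_kernel B d -> (exists e, d e != 0) ->
     exists d', [/\ in_kernel B d', exists e, d' e != 0,
       forall e, d' e != 0 -> d e != 0 & (\sum_e absz (d' e) <= C)%N]) ->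
  forall f, circuits K A f -> (pdeg f <= C)%N.
Proof.
move=> small f cf; have [d [kd nz Ef]] := circuit_lift cf.
have [_ _ irr minf] := cf; rewrite Ef pdeg_lift // in irr minf *.
have [d' [kd' [e0 d'0] sub d'C]] := small d kd nz.
apply: leq_trans d'C; apply: leq_sum => e _.
have prop i : d' e0 * d i = d e0 * d' i.
  apply/eqP; rewrite -subr_eq0; apply/negPn/negP => ni.
  pose h i := d' e0 * d i - d e0 * d' i.
  have nzh : exists i, h i != 0 by exists i.
  have kh : in_kernel B h by apply: kernel_scale_sub.
  have bh : is_binomial (binom K (lift_monomial h) (lift_opp h)).
    by exists (lift_monomial h), (lift_opp h); split=> //; apply: lift_neq.
  apply: (negP (minf _ bh (lift_toric kh))).
  apply/properP; split.
    apply/fintype.subsetP => j; rewrite !vars_lift // /h; set x := (enum_val j).1.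
    by apply: contraNneq => dx; have := sub x; rewrite dx eqxx; lia.
  exists (enum_rank (e0, true)); rewrite vars_lift // enum_rankK /= ?sub //.
  by rewrite /h mulrC subrr eqxx.
apply: (@leq_coprime_proportional _ (fun i => absz (d i)) (fun i => absz (d' i)) e0).
- by rewrite absz_gt0 sub.
- by rewrite absz_gt0.
- by move=> i; rewrite -!abszM prop.
- move=> p p0 /= pd; exact: (irreducible_lift_primitive nz irr p0 pd).
Qed.

Lemma lift_irreducible d e0 : (forall e, (absz (d e) <= 1)%N) -> d e0 = 1 ->
  irreducible_elt (binom K (lift_monomial d) (lift_opp d)).
Proof.
move=> d1 de0; apply: (@irreducible_binom_linear _ _ _ _ (enum_rank (e0, true))).
- by rewrite -/(expo (lift_monomial d) e0 true) expo_lift de0.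
- by rewrite -/(expo (lift_opp d) e0 true) expo_lift de0.
- by move=> j; apply: lift_disjoint.
Qed.

(** The kernel of the lifting consists of the [(d', -d')], so minimality of the support can be
    tested in the kernel of [B]. *)
Lemma lift_circuit d e0 : in_kernel B d -> (forall e, (absz (d e) <= 1)%N) ->
  d e0 = 1 ->
  (forall d', in_kernel B d' -> (exists e, d' e != 0) ->
     (forall e, d' e != 0 -> d e != 0) -> forall e, d e != 0 -> d' e != 0) ->
  circuits K A (binom K (lift_monomial d) (lift_opp d)).
Proof.
move=> kd d1 de0 mind.
have nz : exists e, d e != 0 by exists e0; rewrite de0.
split.
- by exists (lift_monomial d), (lift_opp d); split=> //; apply: lift_neq.
- exact: lift_toric.
- exact: lift_irreducible d1 de0.
move=> g [w [z [wz ->]]] /(toric_binomP _ A_ge0) /lawrenceP [S ker].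
apply/negP => /properP [/fintype.subsetP sub [i]].
rewrite -(enum_valK i); case: (enum_val i) => e b; rewrite vars_lift // enum_rankK /= => de.
rewrite vars_binom // -/(expo w e b) -/(expo z e b) => /negP; apply.
have vw e' b' : (0 < expo w e' b')%N || (0 < expo z e' b')%N -> d e' != 0.
  have := sub (enum_rank (e', b')).
  by rewrite vars_binom // vars_lift // enum_rankK /=; apply.
have : (expo w e true)%:Z - (expo z e true)%:Z != 0.
  apply: (mind _ ker) => //.
    apply: contrapT => /forallNP H; move: wz => /eqP; apply.
    by apply: eq_expo => e' b'; have /negP := H e'; have := S e'; case: b'; lia.
  by move=> e' He; apply: (vw e' true); lia.
by have := S e; case: b; lia.
Qed.

(** Membership of the constant vector 1 in the Graver basis of [B]: what can be split off from it
    has entries 0 and 1. *)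
Hypothesis unsplittable : in_kernel B (fun=> 1) /\
  forall d, in_kernel B d -> (forall e, d e = 0 \/ d e = 1) ->
    (forall e, d e = 0) \/ (forall e, d e = 1).

Lemma lift1_primitive_pair (e0 : E) :
  primitive_pair A (lift_monomial (fun=> 1)) (lift_opp (fun=> 1)).
Proof.
have [k1 min1] := unsplittable.
split; [by apply: lift_neq; exists e0|exact: lift_fiber|].
move=> w z wz /lawrenceP [S ker] /mnm_lepP wu /mnm_lepP zv.
have Hw e b : (expo w e b <= b)%N.
  have : (expo w e b <= expo (lift_monomial (fun=> 1)) e b)%N := wu _.
  by rewrite expo_lift; case: b.
have Hz e b : (expo z e b <= ~~ b)%N.
  have : (expo z e b <= expo (lift_opp (fun=> 1)) e b)%N := zv _.
  by rewrite expo_lift; case: b.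
have [e|H|H] := min1 _ ker.
- by have := Hw e true; have := Hz e true; lia.
- case/negP: wz; apply/eqP/eq_expo => e b; have := H e; have := S e.
  have := Hw e true; have := Hz e true; have := Hw e false; have := Hz e false.
  by case: b; lia.
- split; apply: eq_expo => e b; rewrite expo_lift; have := H e; have := S e;
  have := Hw e true; have := Hz e true; have := Hw e false; have := Hz e false;
  by case: b; lia.
Qed.

(** The binomial of the vector 1 has degree [#|E|] and, suitably oriented, lies in all three sets;
    the bound on primitive pairs makes their maximal degrees exist. *)
Lemma lawrence_degrees (e0 : E) (C : nat) :
  (forall e, exists x, B x e != 0) ->
  (forall d, in_kernel B d -> (exists e, d e != 0) ->
     exists d', [/\ in_kernel B d', exists e, d' e != 0,
       forall e, d' e != 0 -> d e != 0 & (\sum_e absz (d' e) <= C)%N]) ->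
  (exists f, circuits K A f) ->
  exists (M : set {mpoly K[#|{: E * bool}|]}) (dC dM dU dG : nat),
    [/\ injective A, forall i j, 0 <= A i 0 j & markov_basis A M] /\
    [/\ is_max_degree (circuits K A) dC, is_max_degree M dM,
        is_max_degree (universal_groebner K A) dU &
        is_max_degree (graver K A) dG] /\
    [/\ (dC <= C)%N, (#|E| <= dM)%N, (#|E| <= dU)%N & (#|E| <= dG)%N].
Proof.
move=> B_neq0 small [fC cfC].
have [Bd HB] := primitive_pair_bounded A.
have prim_le u v : primitive_pair A u v -> (pdeg (binom K u v) <= Bd)%N.
  move=> P; have [uv _ _] := P; have [uB vB] := HB _ _ P.
  by rewrite pdeg_binom // geq_max uB.
have [u [v [P vu degE irr]]] : exists u v, [/\ primitive_pair A u v, (v < u)%O,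
    (#|E| <= pdeg (binom K u v))%N & irreducible_elt (binom K u v)].
  pose one : E -> int := fun=> 1.
  have P : primitive_pair A (lift_monomial one) (lift_opp one) := lift1_primitive_pair e0.
  have [uv _ _] := P.
  have degu : mdeg (lift_monomial one) = #|E| by rewrite mdeg_lift -[RHS]sum1_card.
  have degv : mdeg (lift_opp one) = #|E| by rewrite mdeg_lift_opp -[RHS]sum1_card.
  (* The larger monomial has to come first. After a swap, irreducibility is seen in the variable
     [(e0, false)]. *)
  case/orP: (le_total (lift_monomial one) (lift_opp one));
    rewrite le_eqVlt ?[lift_opp _ == _]eq_sym (negbTE uv) /= => lt.
    exists (lift_opp one), (lift_monomial one); split=> //.
    - exact: primitive_pairC.
    - by rewrite pdeg_binom 1?eq_sym // degu degv maxnn.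
    apply: (@irreducible_binom_linear _ _ _ _ (enum_rank (e0, false))).
    - by rewrite -/(expo (lift_opp one) e0 false) expo_lift.
    - by rewrite -/(expo (lift_monomial one) e0 false) expo_lift.
    - by move=> j; rewrite orbC; apply: lift_disjoint.
  exists (lift_monomial one), (lift_opp one); split=> //.
    by rewrite pdeg_binom // degu degv maxnn.
  exact: (@lift_irreducible _ e0).
have [dC maxC _] := ex_max_degree cfC (circuit_degree_le small).
have [|f [x [y [Pxy _ ->]]]|dM maxM leM] :=
  @ex_max_degree _ _ (@primitive_binomials K _ _ A) (binom K u v) Bd.
- by exists u, v.
- exact: prim_le.
have [|f Uf|dU maxU leU] :=
  @ex_max_degree _ _ (universal_groebner K A) (binom K u v) Bd.
- exact: primitive_pair_universal (@lawrence_rigid _ _ B) _ _ P vu.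
- have [le [G [le_order redG fG]]] := Uf.
  have [x [y [-> Pxy]]] := reduced_groebner_primitive_pair A_ge0 le_order redG fG.
  exact: prim_le.
have [|f Gf|dG maxG leG] := @ex_max_degree _ _ (graver K A) (binom K u v) Bd.
- exact: primitive_pair_graver.
- by have [x [y [-> Pxy]]] := graver_primitive_pair A_ge0 Gf; apply: prim_le.
exists (@primitive_binomials K _ _ A), dC, dM, dU, dG; split; [|split].
- split; [exact: lawrence_inj|exact: A_ge0|].
  exact: markov_primitive_binomials A_ge0 (@lawrence_rigid _ _ B).
- by split.
- split; rewrite ?(leq_trans degE) //.
  by have [[g cg <-] _] := maxC; apply: circuit_degree_le cg.
Qed.

End LawrenceDegrees.

(** * The tree of triangles *)

Lemma sum_option (R : nmodType) (T : finType) (F : option T -> R) :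
  \sum_x F x = F None + \sum_x F (Some x).
Proof.
rewrite (bigD1 None) //=; congr (_ + _).
rewrite (reindex_omap Some id) => [|[]] //=.
by apply: eq_bigl => x; rewrite eqxx.
Qed.

Lemma sum_node (R : nmodType) (T : finType) (F : option (bool * option T) -> R) :
  \sum_x F x =
  F None + \sum_(s : bool) (F (Some (s, None)) + \sum_x F (Some (s, Some x))).
Proof.
rewrite sum_option (eq_bigr (fun q => F (Some (q.1, q.2)))); last by case.
rewrite -(pair_bigA _ (fun s x => F (Some (s, x)))) /=.
by congr (_ + _); apply: eq_bigr => s _; rewrite sum_option.
Qed.

(* [None] is the edge between the two lower vertices of the top triangle, [Some (s, None)] the
   edge from its upper vertex to the lower vertex on side [s], and [Some (s, Some _)] an edge
   of the subtree hanging there; for [k = 0] the tree is a loop. The equation [(s, None)]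
   lives at the lower vertex on side [s] of the top triangle. Columns have the signs that make
   the closed walk the constant vector 1. *)
Fixpoint tree_edge (k : nat) : finType :=
  if k is k'.+1 then option (bool * option (tree_edge k')) : finType else unit : finType.

Fixpoint tree_row (k : nat) : finType :=
  if k is k'.+1 then (bool * option (tree_row k'))%type : finType else void : finType.

(** The equation at the upper vertex is kept apart from [tree_row], since the surrounding graph also
    contributes to it. A loop meets its vertex twice, hence the 2. *)
Fixpoint root_coef (k : nat) : tree_edge k -> int :=
  match k return tree_edge k -> int with
  | 0 => fun=> 2
  | k'.+1 => fun e => if e is Some (_, None) then 1 else 0
  end.

Fixpoint tree_coef (k : nat) : tree_row k -> tree_edge k -> int :=
  match k return tree_row k -> tree_edge k -> int with
  | 0 => fun _ _ => 0
  | k'.+1 => fun r e =>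
    match r, e with
    | (s, None), None => -1
    | (s, None), Some (t, None) => if s == t then -1 else 0
    | (s, None), Some (t, Some x) => if s == t then root_coef x else 0
    | (s, Some y), Some (t, Some x) => if s == t then tree_coef y x else 0
    | _, _ => 0
    end
  end.

Definition root_value k (d : tree_edge k -> int) : int := \sum_e root_coef e * d e.

Lemma root_value0 (d : tree_edge 0 -> int) : root_value d = 2 * d tt.
Proof. by rewrite /root_value (bigD1 tt) //= big1 ?addr0 // => -[]. Qed.

Lemma root_valueS k (d : tree_edge k.+1 -> int) :
  root_value d = d (Some (true, None)) + d (Some (false, None)).
Proof.
rewrite /root_value sum_node big_bool /= mul0r add0r !mul1r.
by rewrite !big1 ?addr0 // => x _; rewrite mul0r.
Qed.

Definition child k (d : tree_edge k.+1 -> int) s : tree_edge k -> int :=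
  fun x => d (Some (s, Some x)).

Lemma tree_kernel0 (d : tree_edge 0 -> int) : in_kernel (@tree_coef 0) d.
Proof. by case. Qed.

Lemma tree_kernelS k (d : tree_edge k.+1 -> int) :
  in_kernel (@tree_coef k.+1) d <->
  forall s, in_kernel (@tree_coef k) (child d s) /\
    root_value (child d s) = d None + d (Some (s, None)).
Proof.
have sum0 (F : tree_edge k -> int) : \sum_x 0 * F x = 0.
  by rewrite big1 // => x _; rewrite mul0r.
have row_None s : \sum_e @tree_coef k.+1 (s, None) e * d e =
    root_value (child d s) - (d None + d (Some (s, None))).
  rewrite sum_node big_bool /=; case: s => /=;
    rewrite sum0 /root_value /child; ring.
have row_Some s (y : tree_row k) : \sum_e @tree_coef k.+1 (s, Some y) e * d e =
    \sum_x tree_coef y x * child d s x.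
  rewrite sum_node big_bool /=; case: s => /=;
    rewrite sum0 /child; ring.
split=> [H s|H [s [y|]]].
- split=> [y|]; first by rewrite -row_Some H.
  by apply/eqP; rewrite -subr_eq0 -row_None H.
- by rewrite row_Some; case: (H s).
- by rewrite row_None; have [_ ->] := H s; rewrite subrr.
Qed.

Lemma tree_kernel_one k :
  in_kernel (@tree_coef k) (fun=> 1) /\ root_value (fun _ : tree_edge k => 1) = 2.
Proof.
elim: k => [|k [IHk IHr]]; first by split; [exact: tree_kernel0|rewrite root_value0].
by rewrite root_valueS; split=> //; apply/tree_kernelS => s; split.
Qed.

(** A subtree has root value 0 or 2, which is a sum of two entries in {0, 1}; so these two entries
    are equal. The edge [None] enters both sums and makes the two sides agree. *)
Lemma tree_unsplittable k (d : tree_edge k -> int) :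
  in_kernel (@tree_coef k) d -> (forall e, d e = 0 \/ d e = 1) ->
  (root_value d = 0 /\ forall e, d e = 0) \/ (root_value d = 2 /\ forall e, d e = 1).
Proof.
elim: k d => [|k IH] d kd d01.
  by rewrite root_value0; case: (d01 tt) => E; [left|right]; split; rewrite ?E // => -[].
move/tree_kernelS: kd => kd; rewrite root_valueS.
have H s : (d None = 0 /\ d (Some (s, None)) = 0 /\ forall x, d (Some (s, Some x)) = 0) \/
    (d None = 1 /\ d (Some (s, None)) = 1 /\ forall x, d (Some (s, Some x)) = 1).
  have [ks rs] := kd s; have := d01 None; have := d01 (Some (s, None)).
  have [|x|[r0 c0]|[r0 c0]] := IH (child d s).
  - exact: ks.
  - exact: d01.
  - by move=> ? ?; left; split; [lia|split; [lia|exact: c0]].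
  - by move=> ? ?; right; split; [lia|split; [lia|exact: c0]].
have [[a0 [t0 ct]]|[a0 [t0 ct]]] := H true; have [[a0' [f0 cf]]|[a0' [f0 cf]]] := H false.
- by left; rewrite t0 f0; split=> // -[[[] [x|]]|].
- by rewrite a0 in a0'.
- by rewrite a0 in a0'.
- by right; rewrite t0 f0; split=> // -[[[] [x|]]|].
Qed.

(** * Short kernel vectors of the tree *)

Definition node k (a : int) (p : bool -> int) (c : bool -> tree_edge k -> int) :
    tree_edge k.+1 -> int := fun e =>
  match e with
  | None => a
  | Some (s, None) => p s
  | Some (s, Some x) => c s x
  end.

Definition norm1 (T : finType) (d : T -> int) : nat := (\sum_e absz (d e))%N.

Lemma norm1_node k a p (c : bool -> tree_edge k -> int) :
  norm1 (node a p c) =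
  (absz a + (absz (p true) + norm1 (c true)) + (absz (p false) + norm1 (c false)))%N.
Proof. by rewrite /norm1 (sum_node (fun e => absz (node a p c e))) big_bool; apply: addrA. Qed.

(** The value 2 is that of a single loop; integer multiples of [h] then realize every even value at
    the root. *)
Definition short_root_vector k (D : nat) := forall d : tree_edge k -> int,
  in_kernel (@tree_coef k) d -> root_value d != 0 ->
  exists h, [/\ in_kernel (@tree_coef k) h, root_value h = 2,
    forall e, h e != 0 -> d e != 0 & (norm1 h <= D)%N].

(* A child with root value 2 is available whenever the root value of [child d s] is nonzero;
   [t s] is the multiple of it that balances the equation at the vertex [s]. *)
Lemma build_node k D (d : tree_edge k.+1 -> int) (a : int) (p t : bool -> int) :
  short_root_vector k D -> in_kernel (@tree_coef k.+1) d ->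
  (a != 0 -> d None != 0) -> (forall s, p s != 0 -> d (Some (s, None)) != 0) ->
  (forall s, a + p s = 2 * t s) ->
  (forall s, t s != 0 -> root_value (child d s) != 0) ->
  exists h, [/\ in_kernel (@tree_coef k.+1) h,
    h None = a /\ forall s, h (Some (s, None)) = p s,
    forall e, h e != 0 -> d e != 0 &
    (norm1 h <= absz a + absz (p true) + absz (p false) +
       absz (t true) * D + absz (t false) * D)%N].
Proof.
move=> short /tree_kernelS kd ad pd apt td.
have /choice [c Hc] : forall s, exists c : tree_edge k -> int,
    [/\ in_kernel (@tree_coef k) c, root_value c = 2 * t s,
      forall e, c e != 0 -> child d s e != 0 & (norm1 c <= absz (t s) * D)%N].
  move=> s; have [ts|/td rd] := eqVneq (t s) 0.
    exists (fun=> 0); rewrite ts; split; rewrite ?eqxx //.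
    - by move=> y; rewrite big1 // => x _; rewrite mulr0.
    - by rewrite /root_value big1 // => x _; rewrite mulr0.
    - by rewrite /norm1 big1.
  have [ks rs] := kd s; have [h [kh rh sh nh]] := short _ ks rd.
  exists (fun e => t s * h e); split.
  - move=> y; transitivity (t s * \sum_e tree_coef y e * h e); last by rewrite kh mulr0.
    by rewrite mulr_sumr; apply: eq_bigr => e _; ring.
  - transitivity (t s * root_value h); last by rewrite rh mulrC.
    by rewrite mulr_sumr; apply: eq_bigr => e _; ring.
  - by move=> e; rewrite mulf_eq0 negb_or => /andP[_ /sh].
  - rewrite /norm1; under eq_bigr do rewrite abszM.
    by rewrite -big_distrr /= leq_mul.
exists (node a p c); split=> //.
- apply/tree_kernelS => s; have [kc rc _ _] := Hc s; split=> //=.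
  by rewrite apt -rc.
- move=> [[s [x|]]|] //=; [|exact: pd].
  by have [_ _ + _] := Hc s; apply.
- rewrite norm1_node; have [_ _ _ nt] := Hc true; have [_ _ _ nf] := Hc false.
  by lia.
Qed.

(** An odd cycle is reached from the root: the top triangle itself, or one in a subtree, along one
    or two top edges taken twice. Each level costs at most 4 and the final loop 1. *)
Lemma root_vector_short k : short_root_vector k (4 * k + 1).
Proof.
elim: k => [|k IH] d kd rd.
  exists (fun=> 1); split; rewrite ?root_value0 //.
    by move=> []; move: rd; rewrite root_value0; lia.
  by rewrite /norm1 (bigD1 tt) //= big1 // => -[].
have [[_ rt] [_ rf]] := (((tree_kernelS d).1 kd true), ((tree_kernelS d).1 kd false)).
have build := build_node IH kd; move: rd; rewrite root_valueS => rd.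
pose fb (x y : int) s := if s : bool then x else y.
have use (a pt pf tt tf : int) :
    (a != 0 -> d None != 0) -> (pt != 0 -> d (Some (true, None)) != 0) ->
    (pf != 0 -> d (Some (false, None)) != 0) ->
    (tt != 0 -> root_value (child d true) != 0) ->
    (tf != 0 -> root_value (child d false) != 0) ->
    a + pt = 2 * tt -> a + pf = 2 * tf -> pt + pf = 2 ->
    (absz a + absz pt + absz pf <= 4)%N -> (absz tt + absz tf <= 1)%N ->
    exists h, [/\ in_kernel (@tree_coef k.+1) h, root_value h = 2,
      forall e, h e != 0 -> d e != 0 & (norm1 h <= 4 * k.+1 + 1)%N].
  move=> ad ptd pfd ttd tfd Et Ef E2 lea tsum.
  have [||||h [kh [ha hp] sh nh]] := build a (fb pt pf) (fb tt tf); [by []|by case..|].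
  exists h; split=> //; first by rewrite root_valueS !hp.
  apply: leq_trans nh _; rewrite -addnA -mulnDl.
  have := leq_mul tsum (leqnn (4 * k + 1)); move: lea => /leq_add H /H /leq_trans; apply; lia.
move: rt rf rd use; clear build kd.
move: (d None) (d (Some (true, None))) (d (Some (false, None))).
move: (root_value (child d true)) (root_value (child d false)).
move=> sl sr dn dt df rt rf rd use.
have [r0|r0] := eqVneq (sr) 0; last first.
  have [c0|c0] := eqVneq (df) 0; last first.
    by apply: (use 0 0 2 0 1) => //; lia.
  have [l0|l0] := eqVneq (sl) 0; last first.
    by apply: (use 0 2 0 1 0) => //; lia.
  by apply: (use (-2) 2 0 0 (-1)) => //; lia.
have [b0|b0] := eqVneq (dt) 0.
  by apply: (use (-2) 0 2 (-1) 0) => //; lia.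
have [l0|l0] := eqVneq (sl) 0; last first.
  by apply: (use 0 2 0 1 0) => //; lia.
by apply: (use (-1) 1 1 0 0) => //; lia.
Qed.

(** Either everything happens inside one subtree, or two odd cycles are joined at the top triangle:
    at most 4 for its edges and [4 * k + 1] for each of two branches. *)
Lemma rootless_vector_short k (d : tree_edge k -> int) :
  in_kernel (@tree_coef k) d -> root_value d = 0 -> (exists e, d e != 0) ->
  exists h, [/\ in_kernel (@tree_coef k) h, root_value h = 0, exists e, h e != 0,
    forall e, h e != 0 -> d e != 0 & (norm1 h <= 8 * k + 6)%N].
Proof.
elim: k d => [|k IH] d kd rd nz.
  by have [[]] := nz; move: rd; rewrite root_value0; lia.
have [[kt rt] [kf rf]] := (((tree_kernelS d).1 kd true), ((tree_kernelS d).1 kd false)).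
have build := build_node (@root_vector_short k) kd; move: rd; rewrite root_valueS => rd.
pose fb (x y : int) s := if s : bool then x else y.
have use (a pt tt tf : int) :
    (a != 0 -> d None != 0) -> (pt != 0 -> d (Some (true, None)) != 0) ->
    (tt != 0 -> root_value (child d true) != 0) ->
    (tf != 0 -> root_value (child d false) != 0) ->
    a + pt = 2 * tt -> a - pt = 2 * tf -> (a != 0) || (pt != 0) ->
    (absz a + absz pt + absz pt <= 4)%N -> (absz tt + absz tf <= 2)%N ->
    exists h, [/\ in_kernel (@tree_coef k.+1) h, root_value h = 0, exists e, h e != 0,
      forall e, h e != 0 -> d e != 0 & (norm1 h <= 8 * k.+1 + 6)%N].
  move=> ad ptd ttd tfd Et Ef nzap lea tsum.
  have [||||h [kh [ha hp] sh nh]] := build a (fb pt (- pt)) (fb tt tf).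
  - by [].
  - by case; rewrite /fb //; lia.
  - by case.
  - by case.
  exists h; split=> //; first by rewrite root_valueS !hp /fb subrr.
    case/orP: nzap => nz'; first by exists None; rewrite ha.
    by exists (Some (true, None)); rewrite hp.
  apply: leq_trans nh _; rewrite /fb abszN -addnA -mulnDl.
  have := leq_mul tsum (leqnn (4 * k + 1)); move: lea => /leq_add H /H /leq_trans; apply; lia.
have [/andP[/eqP l0 /eqP r0]|lr] :=
    boolP ((root_value (child d true) == 0) && (root_value (child d false) == 0)).
  (* Here the values on the top triangle have pairwise sums 0; the cycle being odd, they vanish. *)
  have [a0 t0 f0] : [/\ d None = 0, d (Some (true, None)) = 0 & d (Some (false, None)) = 0].
    move: rt rf rd; rewrite l0 r0.
    move: (d None) (d (Some (true, None))) (d (Some (false, None))) => x y z.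
    by move=> *; split; lia.
  have lift s : (exists x, d (Some (s, Some x)) != 0) ->
      exists h, [/\ in_kernel (@tree_coef k.+1) h, root_value h = 0, exists e, h e != 0,
      forall e, h e != 0 -> d e != 0 & (norm1 h <= 8 * k.+1 + 6)%N].
    have [ks rs] : in_kernel (@tree_coef k) (child d s) /\ root_value (child d s) = 0.
      by case: s.
    move=> /(IH _ ks rs) [h [kh rh [x hx] sh nh]].
    pose c s' := if s' == s then h else fun=> 0.
    exists (node 0 (fun=> 0) c); split.
    - apply/tree_kernelS => s'; rewrite addr0 /child /= /c; case: eqP => // _; split.
        by move=> y; rewrite big1 // => e _; rewrite mulr0.
      by rewrite /root_value big1 // => e _; rewrite mulr0.
    - by rewrite root_valueS.
    - by exists (Some (s, Some x)); rewrite /= /c eqxx.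
    - move=> [[s' [y|]]|] //=; rewrite /c.
      by case: (eqVneq s' s) => [->|_]; rewrite ?eqxx //; apply: sh.
    - have n0 : norm1 (fun=> 0 : int) = 0%N by move=> T; rewrite /norm1 big1.
      by rewrite norm1_node /c; case: s {ks rs sh c} => /=; rewrite n0; lia.
  have [[[s [x|]]|]] := nz; last by rewrite a0.
  - by move=> nx; apply: (lift s); exists x.
  - by case: s; rewrite ?t0 ?f0.
move: lr rt rf rd use; clear build nz kd.
move: (d None) (d (Some (true, None))) (d (Some (false, None))).
move: (root_value (child d true)) (root_value (child d false)).
move=> sl sr dn dt df lr rt rf rd use.
(* Four cases: odd cycles of both subtrees joined through the root or through the lower edge, or the
   top triangle with an odd cycle of one subtree. *)
have [a0|a0] := eqVneq dn 0; first by apply: (use 0 2 1 (-1)) => //; lia.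
have [b0|b0] := eqVneq dt 0; first by apply: (use 2 0 1 1) => //; lia.
have [l0|l0] := eqVneq sl 0; last by apply: (use 1 1 1 0) => //; lia.
by apply: (use (-1) 1 0 (-1)) => //; lia.
Qed.

(* A circuit with entries in {-1, 0, 1}: a triangle at the bottom and one of its loops. *)
Fixpoint bottom_cycle (k : nat) : tree_edge k.+1 -> int :=
  match k return tree_edge k.+1 -> int with
  | 0 => @node 0 1 (fun s => if s then 1 else -1) (fun s _ => if s then 1 else 0)
  | k'.+1 => @node k'.+1 0 (fun=> 0) (fun s x => if s then bottom_cycle x else 0)
  end.

Lemma bottom_cycle_kernel k :
  in_kernel (@tree_coef k.+1) (@bottom_cycle k) /\ root_value (@bottom_cycle k) = 0.
Proof.
elim: k => [|k [IHk IHr]]; rewrite root_valueS; split=> //.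
  by apply/tree_kernelS => -[]; split; rewrite ?root_value0 //; apply: tree_kernel0.
apply/tree_kernelS => -[]; split=> //; first by move=> y; rewrite big1 // => x _; rewrite mulr0.
by rewrite /root_value big1 // => x _; rewrite mulr0.
Qed.

Lemma bottom_cycle_le1 k e : (absz (@bottom_cycle k e) <= 1)%N.
Proof.
elim: k e => [|k IH]; first by move=> [[[] [[]|]]|].
by move=> [[[] [x|]]|] //; apply: IH.
Qed.

Lemma bottom_cycle_eq1 k : exists e, @bottom_cycle k e = 1.
Proof.
elim: k => [|k [x Ex]]; first by exists None.
by exists (Some (true, Some x)).
Qed.

Lemma bottom_cycle_minimal k (d : tree_edge k.+1 -> int) :
  in_kernel (@tree_coef k.+1) d -> root_value d = 0 ->
  (forall e, d e != 0 -> bottom_cycle e != 0) ->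
  exists t, forall e, d e = t * bottom_cycle e.
Proof.
elim: k d => [|k IH] d /tree_kernelS kd; rewrite root_valueS => rd sub.
  have zero e : bottom_cycle e = 0 -> d e = 0.
    by move=> be; apply/eqP; apply: contraTT isT => /sub; rewrite be.
  have [_ rt] := kd true; have [_ rf] := kd false; rewrite !root_value0 /child in rt rf.
  have x0 : d (Some (false, Some tt)) = 0 by apply: zero.
  rewrite x0 mulr0 in rf; move: rt rf rd x0.
  exists (d None) => -[[[] [[]|]]|] /=; move: rt rf rd x0;
  move: (d None) (d (Some (true, None))) (d (Some (false, None)))
    (d (Some (true, Some tt))) (d (Some (false, Some tt))) => *; lia.
have zero e : bottom_cycle e = 0 -> d e = 0.
  by move=> be; apply/eqP; apply: contraTT isT => /sub; rewrite be.
have [kt rt] := kd true.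
rewrite !zero // addr0 in rt.
have [x|t Ht] := IH (child d true) kt rt; first exact: (sub (Some (true, Some x))).
by exists t => -[[[] [x|]]|] /=; [exact: Ht|rewrite mulr0 zero..].
Qed.

(** * The closed graph *)

(* The root vertex is closed by a loop, the edge [None]. *)
Definition closed_coef k (r : option (tree_row k)) (e : option (tree_edge k)) : int :=
  match r, e with
  | None, None => -2
  | None, Some x => root_coef x
  | Some y, Some x => tree_coef y x
  | Some y, None => 0
  end.

Lemma closed_kernelP k (d : option (tree_edge k) -> int) :
  in_kernel (@closed_coef k) d <->
  in_kernel (@tree_coef k) (fun x => d (Some x)) /\
  root_value (fun x => d (Some x)) = 2 * d None.
Proof.
split=> [H|[H1 H2] [y|]].
- split=> [y|]; first by have := H (Some y); rewrite sum_option /= mul0r add0r.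
  by have := H None; rewrite sum_option /= -/(root_value (fun x => d (Some x))); lia.
- by rewrite sum_option /= mul0r add0r.
- by rewrite sum_option /= -/(root_value (fun x => d (Some x))) H2; lia.
Qed.

Lemma root_coef_ge k x : -2 <= @root_coef k x.
Proof. by case: k x => [|k] // [[s [x|]]|]. Qed.

Lemma tree_coef_ge k y x : -2 <= @tree_coef k y x.
Proof.
elim: k y x => [|k IH] //= [s [y|]] [[t [x|]]|] //=; case: eqP => // _.
exact: root_coef_ge.
Qed.

Lemma closed_coef_ge k r e : -2 <= @closed_coef k r e.
Proof. by case: r e => [y|] [x|] //=; rewrite ?tree_coef_ge ?root_coef_ge. Qed.

(** Nonzero columns keep the two columns of an edge in the lifting distinct. *)
Lemma tree_column_neq0 k (x : tree_edge k) :
  root_coef x != 0 \/ exists y : tree_row k, tree_coef y x != 0.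
Proof.
elim: k x => [|k IH] x; first by left.
case: x => [[s [x|]]|]; [|by left|by right; exists (true, None)].
right; have [rx|[y yx]] := IH x.
  by exists (s, None); rewrite /= eqxx.
by exists (s, Some y); rewrite /= eqxx.
Qed.

Lemma closed_column_neq0 k e : exists r, @closed_coef k r e != 0.
Proof.
case: e => [x|]; last by exists None.
by have [rx|[y yx]] := tree_column_neq0 x; [exists None|exists (Some y)].
Qed.

Lemma closed_unsplittable k : in_kernel (@closed_coef k) (fun=> 1) /\
  forall d, in_kernel (@closed_coef k) d -> (forall e, d e = 0 \/ d e = 1) ->
    (forall e, d e = 0) \/ (forall e, d e = 1).
Proof.
split=> [|d /closed_kernelP [kd rd] d01].
  by apply/closed_kernelP; exact: tree_kernel_one.
have [|[r0 H]|[r0 H]] := tree_unsplittable kd; first by move=> e; apply: d01.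
- by left => -[x|]; [apply: H|move: rd; rewrite r0; lia].
- by right => -[x|]; [apply: H|move: rd; rewrite r0; lia].
Qed.

(** If [d] avoids the root loop, the tree alone supplies the vector; otherwise its root value is
    nonzero, and a tree vector of root value 2 is closed by the loop taken once. *)
Lemma closed_short_vector k (d : option (tree_edge k) -> int) :
  in_kernel (@closed_coef k) d -> (exists e, d e != 0) ->
  exists d', [/\ in_kernel (@closed_coef k) d', exists e, d' e != 0,
    forall e, d' e != 0 -> d e != 0 & (\sum_e absz (d' e) <= 8 * k + 6)%N].
Proof.
move=> /closed_kernelP [kd rd] nz.
have [d0|d0] := eqVneq (d None) 0.
  have [||h [kh rh [x hx] sh nh]] := rootless_vector_short kd; first by rewrite rd d0.
    by case: nz => -[x|]; [exists x|rewrite d0].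
  exists (fun e => if e is Some x then h x else 0); split.
  - by apply/closed_kernelP; rewrite mulr0.
  - by exists (Some x).
  - by case=> [y|] //; apply: sh.
  - by rewrite (sum_option (fun e => absz (if e is Some x then h x else 0))).
have [|h [kh rh sh nh]] := root_vector_short kd; first by rewrite rd; lia.
exists (fun e => if e is Some x then h x else 1); split.
- by apply/closed_kernelP; rewrite mulr1.
- by exists None.
- by case=> [y|] //; apply: sh.
- rewrite (sum_option (fun e => absz (if e is Some x then h x else 1))) /=.
  by move: nh; rewrite /norm1; set s := (\sum_e _)%N; clearbody s; lia.
Qed.

(** A maximal degree has to be attained, so the set of circuits must be inhabited. The depth [k.+1]
    provides a triangle. *)
Lemma closed_circuit (K : fieldType) k :
  exists f, circuits K (lawrence (@closed_coef k.+1)) f.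
Proof.
pose d (e : option (tree_edge k.+1)) : int := if e is Some x then bottom_cycle x else 0.
have [kb rb] := bottom_cycle_kernel k; have [x Ex] := bottom_cycle_eq1 k.
exists (binom K (lift_monomial d) (lift_opp d)).
apply: (lift_circuit K (@closed_coef_ge k.+1) (e0 := Some x)) => //.
- by apply/closed_kernelP; rewrite mulr0.
- by case=> [y|] //; apply: bottom_cycle_le1.
move=> d' /closed_kernelP [kd' rd'] nz sub.
have d'0 : d' None = 0.
  by apply/eqP; apply: contraTT isT => /sub.
have [|y|t Ht] := bottom_cycle_minimal kd'; first by rewrite rd' d'0.
  exact: (sub (Some y)).
have t0 : t != 0.
  case: nz => -[y|]; last by rewrite d'0.
  by rewrite Ht mulf_eq0 negb_or => /andP[].
by case=> [y|] //= by0; rewrite Ht mulf_neq0.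
Qed.

(** * Exponential growth against polynomials *)

Lemma card_tree_edge k : (2 ^ k <= #|tree_edge k|)%N.
Proof.
elim: k => [|k IH]; first by rewrite card_unit.
by rewrite /= card_option card_prod card_bool card_option expnS ltnW // ltnS leq_mul2l ltnW.
Qed.

Lemma leq_expn (m n e : nat) : (m <= n)%N -> (m ^ e <= n ^ e)%N.
Proof. by case: e => // e mn; rewrite leq_exp2r. Qed.

Lemma exp_dominates (c n : nat) : exists k, (2 ^ c * (8 * k.+1 + 7) ^ n < 2 ^ k.+1)%N.
Proof.
(* With [k.+1 = 2 ^ j] the claim reduces to [c + (j + 4) * n < 2 ^ j]; for [j = 2 * t] the right
   side is at least the square of [t.+1], which exceeds the left side. *)
pose t := (c + 7 * n)%N; pose j := (2 * t)%N.
have j0 : (0 < 2 ^ j)%N by rewrite expn_gt0.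
exists (2 ^ j).-1; rewrite prednK //.
have le1 : (8 * 2 ^ j + 7 <= 2 ^ (j + 4))%N.
  by rewrite expnD; move: j0; set x := (2 ^ j)%N; lia.
apply: (@leq_ltn_trans (2 ^ c * (2 ^ (j + 4)) ^ n)%N).
  by rewrite leq_mul2l leq_expn ?orbT.
rewrite -expnM -expnD ltn_exp2l //.
have t2 : (t < 2 ^ t)%N by rewrite ltn_expl.
have : (t.+1 * t.+1 <= 2 ^ j)%N by rewrite /j mulnC expnM mulnn leq_exp2r.
by rewrite /j /t; move: (2 ^ _)%N; nia.
Qed.

(** The bound is uniform in [d], because only an upper bound on the circuit degree is known and [p]
    need not be monotone. It compares every power of [d] with one power of a larger base and sums
    the absolute values of the coefficients. *)
Lemma horner_lt_exp (R : realType) (p : {poly R}) : exists k : nat,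
  forall d : nat, (d <= 8 * k.+1 + 6)%N -> p.[d%:R] < (2 ^ k.+1)%:R.
Proof.
pose S := \sum_(i < size p) `|p`_i|.
have S0 : 0 <= S by apply: sumr_ge0 => i _; apply: normr_ge0.
pose c := Num.truncn S.
have Sc : S <= (2 ^ c.+1)%:R.
  apply: ltW; apply: lt_le_trans (truncnS_gt S) _.
  by rewrite ler_nat ltnW // ltn_expl.
have [k Hk] := exp_dominates c.+1 (size p).
exists k => d dk; apply: le_lt_trans (_ : (2 ^ c.+1 * (8 * k.+1 + 7) ^ size p)%:R < _).
  rewrite natrM; apply: (@le_trans _ _ (S * ((8 * k.+1 + 7) ^ size p)%:R)).
    rewrite horner_coef mulr_suml; apply: ler_sum => i _.
    apply: le_trans (ler_norm _) _; rewrite normrM; apply: ler_wpM2l => //.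
    rewrite -natrX normr_nat ler_nat.
    apply: (@leq_trans ((8 * k.+1 + 7) ^ i)%N).
      by apply: leq_expn; lia.
    by rewrite leq_pexp2l ?(ltnW (ltn_ord i)) //; lia.
  by apply: ler_wpM2r.
by rewrite ltr_nat.
Qed.

Theorem theorem3p9 (K : fieldType) (R : realType) (p : {poly R}) :
  exists (n m : nat) (A : 'I_m -> 'rV[int]_n) (M : set {mpoly K[m]})
         (dC dM dU dG : nat),
    [/\ injective A,
        forall i j, 0 <= A i 0 j &
        markov_basis A M] /\
    [/\ is_max_degree (circuits K A) dC,
        is_max_degree M dM,
        is_max_degree (universal_groebner K A) dU &
        is_max_degree (graver K A) dG] /\
    [/\ p.[dC%:R] < dM%:R,
        p.[dC%:R] < dU%:R &
        p.[dC%:R] < dG%:R].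
Proof.
have [k Hk] := horner_lt_exp p.
have [M [dC [dM [dU [dG [HA [Hmax [leC leM leU leG]]]]]]]] :=
  lawrence_degrees (@closed_coef_ge k.+1) (closed_unsplittable k.+1) None
    (@closed_column_neq0 k.+1) (@closed_short_vector k.+1) (closed_circuit K k).
exists _, _, (lawrence (@closed_coef k.+1)), M, dC, dM, dU, dG; split=> //; split=> //.
have pC := Hk _ leC.
have le (d : nat) : (#|{: option (tree_edge k.+1)}| <= d)%N -> p.[dC%:R] < d%:R.
  move=> cd; apply: lt_le_trans pC _; rewrite ler_nat (leq_trans _ cd) //.
  by rewrite (leq_trans (card_tree_edge k.+1)) // card_option.
by split; apply: le.
Qed.
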